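(* Let the satellite path-loss exponent be $\alpha_{\mathrm s}=2$ and let the channel fading distributions be Rayleigh. For $o\in\{\mathrm{dn},\mathrm{up}\}$ let $$\mathrm{LB}_{\mathrm{up}}^{o}=\log_2\left(1+\frac{\exp\left(\mathbb E\left[\ln\left(G_1^{\mathrm{u_s|s}}P_{\mathrm{u_s}}H_1^{\mathrm s}\|\mathbf u_1^{\mathrm s}-\mathbf x_1\|^{-2}\right)\right]\right)}{\mathbb E[I_{\mathrm s}^{\mathrm{up}}]+\mathbb E[I_{\mathrm{t,up}}^{o}]+\mathbb E[\sigma^2]}\right)$$ be the lower bound of the ergodic spectral efficiency $R_{\mathrm{up}}^{o}$ of the uplink (UL) satellite network under spectrum sharing with downlink (DL, $o=\mathrm{dn}$) or uplink ($o=\mathrm{up}$) terrestrial networks. Then the lower bound under spectrum sharing with DL terrestrial networks is less than that under spectrum sharing with UL terrestrial networks, i.e. $\mathrm{LB}_{\mathrm{up}}^{\mathrm{dn}}<\mathrm{LB}_{\mathrm{up}}^{\mathrm{up}}$, provided the following density ratio is met: $$\frac{\lambda_{\mathrm{u_t}}}{\lambda_{\mathrm b}}\le\frac{P_{\mathrm b}R_{\mathrm b}}{P_{\mathrm{u_t}}R_{\mathrm{u_t}}}\cdot\frac{G^{\mathrm{b_L|s}}\ln\left(\frac{R_{\psi'}^{\mathrm{b|s}}}{R_{\min}^{\mathrm{b|s}}}\right)+G^{\mathrm{b_H|s}}\ln\left(\frac{R_{\max}^{\mathrm{b|s}}}{R_{\psi'}^{\mathrm{b|s}}}\right)}{G^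{\mathrm{u_t|s}}\ln\left(\frac{R_{\max}^{\mathrm{u_t|s}}}{R_{\min}^{\mathrm{u_t|s}}}\right)}.$$
   Context: Geometry. All nodes lie on spheres centered at the origin of $\mathbb{R}^3$. Satellites lie on the sphere of radius $R_{\mathrm s}$; satellite users, terrestrial base stations (BSs) and terrestrial users lie on spheres of radii $R_{\mathrm{u_s}},R_{\mathrm b},R_{\mathrm{u_t}}<R_{\mathrm s}$. $\Phi_{\mathrm{u_s}}=\{\mathbf u_\ell^{\mathrm s}\}$, $\Phi_{\mathrm b}=\{\mathbf b_m\}$, $\Phi_{\mathrm{u_t}}=\{\mathbf u_k^{\mathrm t}\}$ are independent homogeneous Poisson point processes on the respective spheres with densities $\lambda_{\mathrm{u_s}},\lambda_{\mathrm b},\lambda_{\mathrm{u_t}}$. The typical satellite is located at $\mathbf x_1=(0,0,R_{\mathrm s})$ and is served by the nearest satellite user, $\mathbf u_1^{\mathrm s}$. The visible angle from the typical satellite is $\theta_{\mathrm s}$. For $o\in\{\mathrm{u_s},\mathrm b,\mathrm{u_t}\}$ put $R_{\min}^{o|\mathrm s}=R_{\mathrm s}-R_o$ and $R_{\max}^{o|\mathrm s}=R_{\mathrm s}\cos\theta_{\mathrm s}-\sqrt{R_o^2-R_{\mathrm s}^2\sin^2\theta_{\mathrm s}}$. The visible spherical cap $\mathcal A_{o|\mathrm s}$ is the set of points of the sphere of radius $R_o$ at distance at most $R_{\max}^{o|\mathrm s}$ from $\mathbf x_1$. Gains. With carrier frequency $f_c$, speed of light $c_0$, and main-lobe and side-lobe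 antenna gains $G^{\mathrm{main}}$, $G^{\mathrm{side}}$ of satellites (s), satellite users ($\mathrm{u_s}$), terrestrial users ($\mathrm{u_t}$) and BSs (with two side-lobe levels $G_{\mathrm{b_H}}^{\mathrm{side}},G_{\mathrm{b_L}}^{\mathrm{side}}$): $G_1^{\mathrm{u_s|s}}=G_{\mathrm s}^{\mathrm{main}}G_{\mathrm{u_s}}^{\mathrm{main}}(c_0/4\pi f_c)^2$; $G_\ell^{\mathrm{u_s|s}}=G_{\mathrm s}^{\mathrm{side}}G_{\mathrm{u_s}}^{\mathrm{side}}(c_0/4\pi f_c)^2$ for $\ell\ne1$; $G^{\mathrm{u_t|s}}=G_{\mathrm s}^{\mathrm{side}}G_{\mathrm{u_t}}^{\mathrm{side}}(c_0/4\pi f_c)^2$; $G^{\mathrm{b_L|s}}=G_{\mathrm s}^{\mathrm{side}}G_{\mathrm{b_L}}^{\mathrm{side}}(c_0/4\pi f_c)^2$; $G^{\mathrm{b_H|s}}=G_{\mathrm s}^{\mathrm{side}}G_{\mathrm{b_H}}^{\mathrm{side}}(c_0/4\pi f_c)^2$. With threshold elevation angles $\psi_1^{\mathrm{th}}<\psi_2^{\mathrm{th}}$, the effective gain $G^{\mathrm{b|s}}$ of a BS equals $G^{\mathrm{b_H|s}}$ if the elevation angle $\psi$ of $\mathbf x_1$ seen from the BS satisfies $\psi_1^{\mathrm{th}}<\psi\le\psi_2^{\mathrm{th}}$, and $G^{\mathrm{b_L|s}}$ if $\psi>\psi_2^{\mathrm{th}}$. It is assumed that $\psi_1^{\mathrm{th}}<\cos^{-1}\bigl(\tfrac{R_{\mathrm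 s}}{R_{\mathrm b}}\sin\theta_{\mathrm s}\bigr)$, i.e. the typical satellite is in the side lobe of every visible BS. The distance to $\mathbf x_1$ of a BS seeing it at elevation $\psi_2^{\mathrm{th}}$ is $R_{\psi'}^{\mathrm{b|s}}=\sqrt{R_{\mathrm s}^2-R_{\mathrm b}^2\cos^2\psi_2^{\mathrm{th}}}-R_{\mathrm b}\sin\psi_2^{\mathrm{th}}$, with $R_{\min}^{\mathrm{b|s}}\le R_{\psi'}^{\mathrm{b|s}}\le R_{\max}^{\mathrm{b|s}}$. Fading and interference. $H_\ell^{\mathrm s},H_m^{\mathrm s},H_k^{\mathrm s}$ denote the fading powers of the links to the typical satellite from satellite users, BSs and terrestrial users; they all follow one common satellite-channel fading distribution, here Rayleigh (for the amplitudes $\sqrt{H^{\mathrm s}}$), and are independent of the point processes. $P_{\mathrm{u_s}},P_{\mathrm b},P_{\mathrm{u_t}}$ are the transmit powers and $\sigma^2$ is the noise power. With exponent 2, $I_{\mathrm s}^{\mathrm{up}}=\sum_{\mathbf u_\ell^{\mathrm s}\in(\Phi_{\mathrm{u_s}}\cap\mathcal A_{\mathrm{u_s|s}})\setminus\{\mathbf u_1^{\mathrm s}\}}G_\ell^{\mathrm{u_s|s}}P_{\mathrm{u_s}}H_\ell^{\mathrm s}\|\mathbf u_\ell^{\mathrm s}-\mathbf x_1\|^{-2}$, $I_{\mathrm{t,up}}^{\mathrm{dn}}=\sum_{\mathbf b_m\in\Phi_{\mathrm b}\cap\mathcal A_{\mathrm{b|s}}}G^{\mathrm{b|s}}P_{\mathrm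 b}H_m^{\mathrm s}\|\mathbf b_m-\mathbf x_1\|^{-2}$, $I_{\mathrm{t,up}}^{\mathrm{up}}=\sum_{\mathbf u_k^{\mathrm t}\in\Phi_{\mathrm{u_t}}\cap\mathcal A_{\mathrm{u_t|s}}}G^{\mathrm{u_t|s}}P_{\mathrm{u_t}}H_k^{\mathrm s}\|\mathbf u_k^{\mathrm t}-\mathbf x_1\|^{-2}$. The ergodic spectral efficiency is $R_{\mathrm{up}}^{o}=\mathbb E\bigl[\log_2\bigl(1+G_1^{\mathrm{u_s|s}}P_{\mathrm{u_s}}H_1^{\mathrm s}\|\mathbf u_1^{\mathrm s}-\mathbf x_1\|^{-2}/(I_{\mathrm s}^{\mathrm{up}}+I_{\mathrm{t,up}}^{o}+\sigma^2)\bigr)\bigr]$.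
   Formalization: At equality in the density ratio condition the two lower bounds coincide, so strict inequality is proved only for strict ratio inequality, with ≤ at equality; expectations are conditional on an event where the serving satellite user exists, as it is otherwise undefined. *)

(* Defs.v *)
From HB Require Import structures.
From mathcomp Require Import all_boot all_order all_algebra.
From mathcomp Require Import all_classical all_reals all_analysis.

Set Implicit Arguments.
Unset Strict Implicit.
Unset Printing Implicit Defensive.

Import Order.TTheory GRing.Theory Num.Theory.
Import numFieldNormedType.Exports.

Local Open Scope classical_set_scope.
Local Open Scope ring_scope.

(* The library norm on R * R * R is the maximum norm, so the Euclidean
   structure is written out; the measurable structure on R * R * R is the
   product (Borel) one. *)
Notation point3 R := (R * R * R)%type.

Section Space.
Context {R : realType}.
Implicit Types x y : point3 R.

Definition dot3 x y : R := x.1.1 * y.1.1 + x.1.2 * y.1.2 + x.2 * y.2.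
Definition sub3 x y : point3 R := (x.1.1 - y.1.1, x.1.2 - y.1.2, x.2 - y.2).
Definition norm3 x : R := Num.sqrt (dot3 x x).
Definition dist3 x y : R := norm3 (sub3 x y).

(* t is the colatitude, p the longitude *)
Definition spherical (r t p : R) : point3 R :=
  (r * (sin t * cos p), r * (sin t * sin p), r * cos t).

(* surface area of the part of B on the sphere of radius r centered at the
   origin; the area element is r^2 sin t dt dp *)
Definition sphere_area (r : R) (B : set (point3 R)) : R :=
  fine (\int[lebesgue_measure]_(t in [set` `[0, pi]%R])
          \int[lebesgue_measure]_(p in [set` `[0, 2 * pi]%R])
            (r ^+ 2 * sin t * \1_B (spherical r t p))%:E)%E.

(* Elevation above the local horizontal plane of b at which x is seen from b.
   In the range [-pi/2, pi/2]. *)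
Definition elevation b x : R :=
  asin (dot3 (sub3 x b) b / (norm3 (sub3 x b) * norm3 b)).

End Space.

Section Probability.
Context {d : measure_display} {T : measurableType d} {R : realType}.
Variable P : probability T R.

Definition mutually_independent (I : Type) (F : I -> set (set T)) : Prop :=
  forall (n : nat) (j : 'I_n -> I) (E : 'I_n -> set T),
    injective j -> (forall i, F (j i) (E i)) ->
    P (\bigcap_i E i) = (\prod_i fine (P (E i)))%:E.

(* E[X | W] for an event W of positive probability *)
Definition cond_expectation (W : set T) (X : T -> R) : \bar R :=
  ((\int[P]_(w in W) (X w)%:E) / P W)%E.

Definition rayleigh_pdf (s x : R) : R :=
  if 0 <= x then x / s ^+ 2 * expR (- (x ^+ 2) / (2 * s ^+ 2)) else 0.

Definition rayleigh_distributed (s : R) (X : T -> R) : Prop :=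
  forall B : set R, measurable B ->
    P (X @^-1` B) = (\int[lebesgue_measure]_(x in B) (rayleigh_pdf s x)%:E)%E.

(* The library's [poisson_pmf] is identically 1 at rate 0, which is not the
   law of a count on a null set; here rate 0 gives the point mass at 0. *)
Definition poisson_weight (a : R) (k : nat) : R :=
  a ^+ k / k`!%:R * expR (- a).

End Probability.

(* A random finite collection of points, with an enumeration: in the outcome w
   its points are [pp_point m w] for m < [pp_size w]; values of [pp_point] at
   larger indices are irrelevant. *)
Record point_process (T : Type) (R : realType) := PointProcess {
  pp_size : T -> nat;
  pp_point : nat -> T -> point3 R }.

Section PointProcess.
Context {d : measure_display} {T : measurableType d} {R : realType}.
Implicit Types Phi : point_process T R.

Definition pp_event Phi (m : nat) (B : set (point3 R)) : set T :=
  [set w | (m < pp_size Phi w)%N /\ B (pp_point Phi m w)].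

(* the sigma-algebra of the enumerated point process *)
Definition sigma_pp Phi : set (set T) :=
  <<s [set E | exists m B, measurable B /\ E = pp_event Phi m B] >>.

Definition pp_count Phi (B : set (point3 R)) (w : T) : nat :=
  (\sum_(0 <= m < pp_size Phi w | pp_point Phi m w \in B) 1)%N.

(* Homogeneous Poisson point process of density lambda on the sphere of radius
   r: counts in disjoint Borel sets are independent and Poisson distributed
   with mean lambda times the area. *)
Definition poisson_on_sphere (P : probability T R) (r lambda : R) Phi : Prop :=
  (forall m B, measurable B -> measurable (pp_event Phi m B)) /\
  forall (n : nat) (B : 'I_n -> set (point3 R)) (k : 'I_n -> nat),
    (forall i, measurable (B i)) -> trivIset setT B ->
    P (\bigcap_i [set w | pp_count Phi (B i) w = k i]) =
      (\prod_i poisson_weight (lambda * sphere_area r (B i)) (k i))%:E.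

End PointProcess.

Inductive node := sat_user | base_station | terr_user.

Record network (R : realType) := Network {
  R_s : R;                     (* radius of the satellites' sphere *)
  node_radius : node -> R;
  theta_s : R;                 (* visible angle *)
  density : node -> R;
  power : node -> R;
  f_c : R;
  c_0 : R;
  G_s_main : R;
  G_s_side : R;
  G_us_main : R;
  G_us_side : R;
  G_ut_side : R;
  G_b_main : R;
  G_bH_side : R;
  G_bL_side : R;
  psi1 : R;
  psi2 : R;
  noise : R }.                 (* sigma^2 *)

Section Geometry.
Context {R : realType}.
Variable N : network R.

Definition sat1 : point3 R := (0, 0, R_s N).

Definition R_min (o : node) : R := R_s N - node_radius N o.

Definition R_max (o : node) : R :=
  R_s N * cos (theta_s N)
  - Num.sqrt (node_radius N o ^+ 2 - R_s N ^+ 2 * sin (theta_s N) ^+ 2).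

Definition R_psi : R :=
  Num.sqrt (R_s N ^+ 2 - node_radius N base_station ^+ 2 * cos (psi2 N) ^+ 2)
  - node_radius N base_station * sin (psi2 N).

Definition visible_cap (o : node) : set (point3 R) :=
  [set x | norm3 x = node_radius N o /\ dist3 x sat1 <= R_max o].

Definition carrier_gain : R := (c_0 N / (4 * pi * f_c N)) ^+ 2.
Definition G_us_1 : R := G_s_main N * G_us_main N * carrier_gain.
Definition G_us : R := G_s_side N * G_us_side N * carrier_gain.
Definition G_ut : R := G_s_side N * G_ut_side N * carrier_gain.
Definition G_bL : R := G_s_side N * G_bL_side N * carrier_gain.
Definition G_bH : R := G_s_side N * G_bH_side N * carrier_gain.

(* The last case (satellite in the main lobe of the BS) does not occur for
   visible BSs, by the assumption [psi1_visible] below. *)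
Definition G_b (b : point3 R) : R :=
  if psi2 N < elevation b sat1 then G_bL
  else if psi1 N < elevation b sat1 then G_bH
  else G_s_side N * G_b_main N * carrier_gain.

Record network_assumptions : Prop := NetworkAssumptions {
  radius_gt0 : forall o, 0 < node_radius N o;
  radius_lt : forall o, node_radius N o < R_s N;
  theta_s_range : 0 < theta_s N < pi / 2;
  (* the square root in R_max is that of a nonnegative number *)
  cap_defined : forall o, R_s N * sin (theta_s N) <= node_radius N o;
  density_gt0 : forall o, 0 < density N o;
  power_gt0 : forall o, 0 < power N o;
  f_c_gt0 : 0 < f_c N;
  c_0_gt0 : 0 < c_0 N;
  G_s_main_gt0 : 0 < G_s_main N;
  G_s_side_gt0 : 0 < G_s_side N;
  G_us_main_gt0 : 0 < G_us_main N;
  G_us_side_gt0 : 0 < G_us_side N;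
  G_ut_side_gt0 : 0 < G_ut_side N;
  G_b_main_gt0 : 0 < G_b_main N;
  G_bH_side_gt0 : 0 < G_bH_side N;
  G_bL_side_gt0 : 0 < G_bL_side N;
  psi1_ge : - (pi / 2) <= psi1 N;
  psi1_lt_psi2 : psi1 N < psi2 N;
  psi2_le : psi2 N <= pi / 2;
  psi1_visible :
    psi1 N < acos (R_s N / node_radius N base_station * sin (theta_s N));
  R_psi_range : R_min base_station <= R_psi <= R_max base_station;
  noise_ge0 : 0 <= noise N }.

Definition density_ratio_bound : R :=
  power N base_station * node_radius N base_station
    / (power N terr_user * node_radius N terr_user)
  * ((G_bL * ln (R_psi / R_min base_station)
      + G_bH * ln (R_max base_station / R_psi))
     / (G_ut * ln (R_max terr_user / R_min terr_user))).

End Geometry.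

Section Signals.
Context {d : measure_display} {T : measurableType d} {R : realType}.
Variables (P : probability T R) (N : network R).
Variables (Phi : node -> point_process T R) (H : node -> nat -> {RV P >-> R}).

(* the sigma-algebra jointly generated by all fading powers *)
Definition sigma_fading : set (set T) :=
  <<s [set E | exists o m B, measurable B /\ E = H o m @^-1` B] >>.

(* Indices start at 0: index 0 is the serving satellite user u_1. *)
Record stochastic_assumptions (s : R) : Prop := StochasticAssumptions {
  Phi_poisson :
    forall o, poisson_on_sphere P (node_radius N o) (density N o) (Phi o);
  nearest_first : forall w l, (l < pp_size (Phi sat_user) w)%N ->
    dist3 (pp_point (Phi sat_user) 0 w) (sat1 N)
      <= dist3 (pp_point (Phi sat_user) l w) (sat1 N);
  scale_gt0 : 0 < s;
  fading_ge0 : forall o m w, 0 <= H o m w;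
  fading_rayleigh :
    forall o m, rayleigh_distributed P s (fun w => Num.sqrt (H o m w));
  (* joint independence of the three processes and of the fading family *)
  processes_fading_independent :
    mutually_independent P (fun i : option node =>
      if i is Some o then sigma_pp (Phi o) else sigma_fading) }.

Definition path_loss (x : point3 R) : R := dist3 x (sat1 N) ^- 2.

Definition signal (w : T) : R :=
  G_us_1 N * power N sat_user * H sat_user 0 w
  * path_loss (pp_point (Phi sat_user) 0 w).

Definition I_s_up (w : T) : R :=
  \sum_(1 <= l < pp_size (Phi sat_user) w
         | pp_point (Phi sat_user) l w \in visible_cap N sat_user)
    G_us N * power N sat_user * H sat_user l w
    * path_loss (pp_point (Phi sat_user) l w).

Definition I_t_dn (w : T) : R :=
  \sum_(0 <= m < pp_size (Phi base_station) w
         | pp_point (Phi base_station) m w \in visible_cap N base_station)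
    G_b N (pp_point (Phi base_station) m w)
    * power N base_station * H base_station m w
    * path_loss (pp_point (Phi base_station) m w).

Definition I_t_up (w : T) : R :=
  \sum_(0 <= k < pp_size (Phi terr_user) w
         | pp_point (Phi terr_user) k w \in visible_cap N terr_user)
    G_ut N * power N terr_user * H terr_user k w
    * path_loss (pp_point (Phi terr_user) k w).

(* A Poisson process on a sphere is empty with positive probability, and then
   there is no serving user and the signal is undefined. Expectations are thus
   conditional on an event [served], determined by the satellite users, on
   which u_1 exists: e.g. that there is a satellite user, or a visible one. *)
Definition serving_event (served : set T) : Prop :=
  [/\ sigma_pp (Phi sat_user) served, (0 < P served)%E
    & served `<=` [set w | (0 < pp_size (Phi sat_user) w)%N]].

Definition log2e (x : \bar R) : \bar R := (lne x / (ln 2)%:E)%E.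

Definition LB_up (served : set T) (I_t : T -> R) : \bar R :=
  let E := cond_expectation P served in
  log2e (1 + expeR (E (fun w => ln (signal w)))
             / (E I_s_up + E I_t + E (cst (noise N))))%E.

End Signals.

(* Main.v *)
(* By Campbell's formula and the independence of the fading from the point
   processes, the mean interference of a terrestrial network is the mean
   fading power times the density times the integral of gain / distance^2 over
   the visible cap.  In terms of the colatitude t the squared distance is
   R_s^2 + R^2 - 2 R_s R cos t, so that the inverse-square law integrates to
   (2 pi R / R_s) ln(rho2 / rho1) over the shell rho1 <= distance <= rho2.  For
   the base stations the cap splits at the distance R_psi, as the elevation
   angle decreases with the distance.  The density ratio condition compares the
   two means thus computed, and the lower bound decreases strictly with the mean
   interference as soon as the mean of the logarithm of the signal and the mean
   of the remaining interference are finite. *)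
Require Import Defs.
From HB Require Import structures.
From mathcomp Require Import all_boot all_order all_algebra.
From mathcomp Require Import all_classical all_reals all_analysis.
(* measurable_realfun comes last for its measurable structure on [\bar R] to be
   the one inferred. *)
From mathcomp Require Import measurable_realfun ring lra.

Set Implicit Arguments.
Unset Strict Implicit.
Unset Printing Implicit Defensive.

Import Order.TTheory GRing.Theory Num.Theory.
Import numFieldNormedType.Exports.

Local Open Scope classical_set_scope.
Local Open Scope ring_scope.

(** * Integrals against densities *)

(** The hypotheses speak only of counts and of events: no law of an individual point is given, and
    the enumeration of a process is arbitrary apart from the serving user. Campbell's formula and
    every use of independence are therefore reduced to one principle: two weighted measures, carried
    to a common space by two maps, give equal integrals as soon as they give equal mass to each
    Borel set there.

    The event [served] belongs to the sigma-algebra of the satellite users. Conditioning on it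
    leaves the means of the two terrestrial interferences unchanged, but it does affect the
    satellite interference and the signal. Those two quantities are the same in both lower bounds,
    so they are only shown to have finite conditional means.

    Both terrestrial means are the same positive multiple of the two sides of the density ratio
    condition. At equality of the ratio the two lower bounds thus coincide, which is why the strict
    conclusion is attached to the strict ratio. *)

Section Densities.
Context {R : realType}.
Local Open Scope ereal_scope.
Import HBNNSimple.

(** Monotone convergence along simple functions approximating [f]. The simple functions live on [Y]
    alone, so the right-hand side sees [X], [mu], [h] and [phi] only through the [h]-weighted masses
    of preimages of Borel sets; this is what makes two different spaces comparable. *)
Lemma approx_integral_density d1 d2 (X : measurableType d1)
    (Y : measurableType d2) (mu : {measure set X -> \bar R})
    (D : set X) (h : X -> R) (phi : X -> Y) (f : Y -> \bar R)
    (mf : measurable_fun setT f) :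
  measurable D -> measurable_fun D h -> (forall x, D x -> (0 <= h x)%R) ->
  measurable_fun D phi -> (forall y, 0 <= f y) ->
  let g := nnsfun_approx measurableT mf in
  \int[mu]_(x in D) ((h x)%:E * f (phi x)) =
  lim (\sum_(r \in range (g n))
    r%:E * \int[mu]_(x in D `&` phi @^-1` (g n @^-1` [set r])) (h x)%:E
    @[n --> \oo]).
Proof.
move=> mD mh h0 mphi f0 g.
have gf y : EFin (g n y) @[n --> \oo] --> f y.
  by apply: (cvg_nnsfun_approx measurableT mf) => // x _; exact: f0.
have mgphi n : measurable_fun D (fun x => (g n (phi x))%:E).
  by apply/measurable_EFinP; exact: measurableT_comp.
have -> : \int[mu]_(x in D) ((h x)%:E * f (phi x)) =
    lim (\int[mu]_(x in D) ((h x)%:E * (g n (phi x))%:E) @[n --> \oo]).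
  rewrite -monotone_convergence//.
  - by apply: eq_integral => x _; apply/esym/cvg_lim => //; exact: cvgeZl.
  - by move=> n; apply: emeasurable_funM => //; exact/measurable_EFinP.
  - by move=> n x Dx; rewrite mule_ge0 ?lee_fin ?h0.
  - move=> x Dx a b ab; rewrite lee_wpmul2l ?lee_fin ?h0//.
    exact/lefP/nd_nnsfun_approx.
congr (lim (_ @ \oo)); apply/funext => n.
transitivity (\int[mu]_(x in D) (\sum_(r \in range (g n))
    (h x)%:E * (r * \1_(g n @^-1` [set r]) (phi x))%:E)).
  apply: eq_integral => x _; rewrite (fimfunE (g n) (phi x)) -fsumEFin//.
  by rewrite ge0_mule_fsumr// => r; exact: nnfun_muleindic_ge0.
rewrite ge0_integral_fsum//; last 2 first.
- move=> r; apply: emeasurable_funM; first exact/measurable_EFinP.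
  apply/measurable_EFinP; apply: measurable_funM => //.
  exact: (measurableT_comp (measurable_indic _)).
- move=> r x Dx; rewrite mule_ge0 ?lee_fin ?h0// -lee_fin.
  exact: nnfun_muleindic_ge0.
apply: eq_fsbigr => r; rewrite inE => -[y _ <-] {r}.
set B := g n @^-1` _.
have mB : measurable B by exact: measurable_funPTI.
rewrite integral_mkcondr -ge0_integralZl//=.
- by apply: eq_integral => x _; rewrite epatch_indic/= EFinM muleCA.
- rewrite epatch_indic; apply: emeasurable_funM; first exact/measurable_EFinP.
  apply/measurable_EFinP.
  change (measurable_fun D ((\1_B : Y -> R) \o phi)).
  exact: (measurableT_comp (measurable_indic mB)).
- by move=> x Dx; rewrite epatch_indic mule_ge0 ?lee_fin ?h0.
- by rewrite lee_fin.
Qed.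

(** The hypothesis says that the images of the two weighted measures agree; phrasing it through
    masses avoids constructing these images as measures. Independence is used below by choosing a
    fading power or an indicator as one weight and its mean as the other. *)
Lemma eq_integral_density d1 d2 d3 (X1 : measurableType d1)
    (X2 : measurableType d2) (Y : measurableType d3)
    (mu1 : {measure set X1 -> \bar R}) (mu2 : {measure set X2 -> \bar R})
    (D1 : set X1) (D2 : set X2) (h1 : X1 -> R) (h2 : X2 -> R)
    (phi1 : X1 -> Y) (phi2 : X2 -> Y) :
  measurable D1 -> measurable_fun D1 h1 -> (forall x, D1 x -> (0 <= h1 x)%R) ->
  measurable_fun D1 phi1 ->
  measurable D2 -> measurable_fun D2 h2 -> (forall x, D2 x -> (0 <= h2 x)%R) ->
  measurable_fun D2 phi2 ->
  (forall B, measurable B ->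
    \int[mu1]_(x in D1 `&` phi1 @^-1` B) (h1 x)%:E =
    \int[mu2]_(x in D2 `&` phi2 @^-1` B) (h2 x)%:E) ->
  forall f : Y -> \bar R, measurable_fun setT f -> (forall y, 0 <= f y) ->
  \int[mu1]_(x in D1) ((h1 x)%:E * f (phi1 x)) =
  \int[mu2]_(x in D2) ((h2 x)%:E * f (phi2 x)).
Proof.
move=> mD1 mh1 h10 mphi1 mD2 mh2 h20 mphi2 h12 f mf f0.
rewrite (approx_integral_density mu1 mf mD1)// (approx_integral_density mu2 mf
  mD2)//.
congr (lim (_ @ \oo)); apply/funext => n; apply: eq_fsbigr => r _.
by rewrite h12//; exact: measurable_funPTI.
Qed.

Lemma ge0_integral_density d1 d2 (X : measurableType d1) (Y : measurableType d2)
    (mu : {measure set X -> \bar R}) (nu : {measure set Y -> \bar R})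
    (D : set X) (h : X -> R) (phi : X -> Y) :
  measurable D -> measurable_fun D h -> (forall x, D x -> (0 <= h x)%R) ->
  measurable_fun D phi ->
  (forall B, measurable B ->
    nu B = \int[mu]_(x in D `&` phi @^-1` B) (h x)%:E) ->
  forall f : Y -> \bar R, measurable_fun setT f -> (forall y, 0 <= f y) ->
  \int[nu]_y f y = \int[mu]_(x in D) ((h x)%:E * f (phi x)).
Proof.
move=> mD mh h0 mphi nuE f mf f0.
rewrite -(@eq_integral_density _ _ _ _ _ _ nu mu setT D (cst 1%R) h id phi)//.
- by apply: eq_integral => y _; rewrite mul1e.
- by move=> B mB; rewrite -nuE// setTI preimage_id (integral_cst nu mB 1) mul1e.
Qed.
End Densities.

(** * Poisson counts *)

Section Counts.
Context {R : realType}.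
Local Open Scope ereal_scope.

(** Sums over the points of a process have a random number of terms. Padding them with zeros gives a
    series over a fixed index set, which can be exchanged with the expectation. *)
Lemma nneseries_finite_support (n k : nat) (Q : pred nat) (g : nat -> R) :
  (forall m, (0 <= g m)%R) ->
  \sum_(m <oo) (if [&& (m < n)%N, (k <= m)%N & Q m] then g m else 0%R)%:E =
  (\sum_(k <= m < n | Q m) g m)%:E.
Proof.
move=> g0; rewrite (nneseries_split 0 n)/=; last first.
  by move=> m _; rewrite lee_fin; case: ifP.
rewrite add0n [X in _ + X]eseries0 ?adde0; last first.
  by move=> m nm _; rewrite ltnNge nm.
rewrite sumEFin; congr (_%:E).
rewrite [RHS](big_nat_widenl _ 0%N)// [RHS]big_mkcond/=.
by apply: eq_big_nat => m /andP[_ ->]; rewrite [Q m && _]andbC.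
Qed.

(** The factor k cancels against k!, so the partial sum shifted by one is a exp(-a) times a partial
    sum of the exponential series. *)
Lemma poisson_mean (a : R) :
  \sum_(k <oo) (k%:R * poisson_weight a k)%:E = a%:E.
Proof.
pose S n := \sum_(0 <= k < n) (k%:R * poisson_weight a k)%:E.
suff : S n @[n --> \oo] --> a%:E by move/cvg_lim; exact.
rewrite -cvg_shiftS.
have SE n : S n.+1 = (a * expR (- a) * series (exp_coeff a) n)%:E.
  rewrite /S sumEFin big_nat_recl// mul0r add0r /series/= mulr_sumr.
  congr (_%:E); apply: eq_big_nat => k _.
  rewrite /poisson_weight /exp_coeff/= exprS factS natrM.
  have k1 : (k.+1%:R != 0 :> R)%R by rewrite pnatr_eq0.
  have kf : (k`!%:R != 0 :> R)%R by rewrite pnatr_eq0 -lt0n fact_gt0.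
  by field; rewrite kf nat1r.
under eq_fun do rewrite SE.
apply: cvg_EFin; first exact: nearW.
rewrite [X in _ --> X](_ : a = (a * expR (- a) * expR a)%R); last first.
  by rewrite -mulrA -expRD addNr expR0 mulr1.
apply: cvgM; first exact: cvg_cst.
exact: is_cvg_series_exp_coeff.
Qed.

Section Process.
Context {d : measure_display} {T : measurableType d}.
Variables (P : probability T R) (r lambda : R) (Phi : point_process T R).
Hypothesis hPhi : poisson_on_sphere P r lambda Phi.
Implicit Types B : set (point3 R).

Definition pp_alive m : set T := [set w | (m < pp_size Phi w)%N].

Lemma pp_eventE m B : pp_event Phi m B = pp_alive m `&` pp_point Phi m @^-1` B.
Proof. by []. Qed.

Lemma measurable_pp_event m B : measurable B -> measurable (pp_event Phi m B).
Proof. exact: hPhi.1. Qed.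

Lemma measurable_pp_alive m : measurable (pp_alive m).
Proof.
have := measurable_pp_event m (@measurableT _ (point3 R)).
by rewrite pp_eventE preimage_setT setIT.
Qed.

Lemma measurable_pp_point m : measurable_fun (pp_alive m) (pp_point Phi m).
Proof. by move=> _ B mB; exact: measurable_pp_event. Qed.

Lemma pp_count_series B w :
  \sum_(m <oo) (\1_(pp_event Phi m B) w : R)%:E =
  ((pp_count Phi B w)%:R : R)%:E.
Proof.
transitivity (\sum_(0 <= m < pp_size Phi w | pp_point Phi m w \in B) 1 : R)%:E;
  last by rewrite /pp_count natr_sum.
rewrite -nneseries_finite_support//; apply: eq_eseriesr => m _; congr (_%:E).
rewrite indicE leq0n/= -[LHS]mulr1 mulr_natl mulrb; congr (if _ then _ else _).
by apply/idP/andP => [/set_mem[mw /mem_set //]|[mw /set_mem Bw]]; exact/mem_set.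
Qed.

(** [poisson_on_sphere] grants measurability only of the events [pp_event]; the count inherits it as
    the series of their indicators. *)
Lemma measurable_pp_count B : measurable B ->
  measurable_fun setT (fun w => (pp_count Phi B w)%:R%:E : \bar R).
Proof.
move=> mB; under eq_fun do rewrite -pp_count_series.
apply: ge0_emeasurable_sum => // m _.
apply/measurable_EFinP/measurable_indic; exact: measurable_pp_event.
Qed.

Lemma measurable_pp_count_eq B k : measurable B ->
  measurable [set w | pp_count Phi B w = k].
Proof.
move=> mB; have := measurable_pp_count mB measurableT (emeasurable_set1
  k%:R%:E).
rewrite setTI; congr measurable; apply/seteqP; split=> w /=.
  by case=> wk; apply/eqP; rewrite -(eqr_nat R) wk.
by move=> ->.
Qed.

Lemma pp_count_law B k : measurable B ->
  P [set w | pp_count Phi B w = k] =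
  (poisson_weight (lambda * sphere_area r B) k)%:E.
Proof.
move=> mB; have := hPhi.2 1%N (fun=> B) (fun=> k) (fun=> mB).
rewrite big_ord1 => <-.
  congr (P _); apply/seteqP; split => [w/= wk i _//|w /(_ ord0 Logic.I)//].
by apply/trivIsetP => i j; rewrite !ord1 eqxx.
Qed.

(** The expected count, computed in two ways: point by point through indicators, and value by value
    through the Poisson law. *)
Lemma pp_intensity B : measurable B ->
  \sum_(m <oo) P (pp_event Phi m B) = (lambda * sphere_area r B)%:E.
Proof.
move=> mB; rewrite -poisson_mean.
transitivity (\int[P]_w (pp_count Phi B w)%:R%:E).
  under [RHS]eq_integral do rewrite -pp_count_series.
  rewrite integral_nneseries//.
  - apply: eq_eseriesr => m _; rewrite integral_indic ?setIT//.
    exact: measurable_pp_event.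
  - move=> m; apply/measurable_EFinP/measurable_indic.
    exact: measurable_pp_event.
(* The count is written as the sum over k of k times the indicator that it equals k; for each
   outcome a single term survives. *)
transitivity (\int[P]_w
    (\sum_(k <oo) k%:R%:E * (\1_[set w | pp_count Phi B w = k] w)%:E)).
  apply: eq_integral => w _.
  rewrite (nneseriesD1 (n := pp_count Phi B w))//.
  rewrite indicE mem_set// mule1 eseries0 ?adde0// => k _ /= ck.
  by rewrite indicE memNset ?mule0//= => wk; move: ck; rewrite wk eqxx.
rewrite integral_nneseries//; last first.
  move=> k; apply/measurable_EFinP; apply: measurable_funM => //.
  exact/measurable_indic/measurable_pp_count_eq.
apply: eq_eseriesr => k _; rewrite ge0_integralZl//; last first.
  exact/measurable_EFinP/measurable_indic/measurable_pp_count_eq.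
rewrite integral_indic// ?setIT; last exact: measurable_pp_count_eq.
by rewrite EFinM -pp_count_law.
Qed.

End Process.
End Counts.

(** * Campbell's formula *)

Section Tonelli.
Context {R : realType}.
Local Open Scope ereal_scope.
Local Notation mu := (@lebesgue_measure R).

(** Extension by zero reduces this to Tonelli on the whole plane. Nonnegativity is asked only on the
    rectangle because the area element contains sin t, which changes sign outside [0, pi]. *)
Lemma integral_setX (A B : set R) (f : R * R -> \bar R) :
  measurable A -> measurable B -> measurable_fun setT f ->
  (forall z, (A `*` B) z -> 0 <= f z) ->
  \int[mu \x mu]_(z in A `*` B) f z =
  \int[mu]_(x in A) \int[mu]_(y in B) f (x, y).
Proof.
move=> mA mB mf f0; have mAB : measurable (A `*` B) by exact: measurableX.
rewrite integral_mkcond fubini_tonelli1; last 2 first.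
- by apply/(measurable_restrictT _ mAB); exact: measurable_funTS.
- by move=> z; exact: erestrict_ge0.
rewrite [RHS]integral_mkcond; apply: eq_integral => x _.
rewrite /fubini_F patchE; case: ifPn => [/set_mem Ax|/negP Ax].
  rewrite [RHS]integral_mkcond; apply: eq_integral => y _; rewrite !patchE.
  congr (if _ then _ else _).
  by apply/idP/idP => [/set_mem[_ /mem_set]|/set_mem By]//; exact/mem_set.
apply: integral0_eq => y _; rewrite patchE ifF//.
by apply/negP => /set_mem[/= /mem_set].
Qed.
End Tonelli.

Section Sphere.
Context {R : realType}.
Local Open Scope ereal_scope.
Local Notation mu := (@lebesgue_measure R).
Implicit Types B : set (point3 R).

Lemma measurable_spherical (r : R) :
  measurable_fun setT (fun z : R * R => spherical r z.1 z.2).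
Proof.
have msin : measurable_fun setT (@sin R).
  by apply: continuous_measurable_fun; exact: continuous_sin.
have mcos : measurable_fun setT (@cos R).
  by apply: continuous_measurable_fun; exact: continuous_cos.
have m1 (f : R -> R) : measurable_fun setT f ->
    measurable_fun setT (fun z : R * R => f z.1).
  by move=> mf; exact: measurableT_comp.
have m2 (f : R -> R) : measurable_fun setT f ->
    measurable_fun setT (fun z : R * R => f z.2).
  by move=> mf; exact: measurableT_comp.
apply/measurable_fun_pairP; split => /=; last first.
  by apply: measurable_funM => //; exact: m1.
apply/measurable_fun_pairP; split => /=;
  by apply: measurable_funM => //; apply: measurable_funM;
    [exact: m1|exact: m2].
Qed.

Let rect : set (R * R) := [set` `[0%R, pi]%R] `*` [set` `[0%R, 2 * pi]%R].

Let measurable_rect : measurable rect.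
Proof. exact: measurableX. Qed.

Let area_density (r : R) (z : R * R) : R := (r ^+ 2 * sin z.1)%R.

Let measurable_area_density r : measurable_fun setT (area_density r).
Proof.
apply: measurable_funM => //.
apply: (measurableT_comp (f := @sin R : _ -> R)) => //.
by apply: continuous_measurable_fun; exact: continuous_sin.
Qed.

Let area_density_ge0 r z : rect z -> (0 <= area_density r z)%R.
Proof.
case: z => t p [/= + _]; rewrite in_itv/= => t0pi.
by rewrite mulr_ge0 ?sqr_ge0// sin_ge0_pi// in_itv.
Qed.

Lemma sphere_integralE (r : R) (f : point3 R -> R) :
  measurable_fun setT f -> (forall x, 0 <= f x)%R ->
  \int[mu]_(t in [set` `[0%R, pi]%R]) \int[mu]_(p in [set` `[0%R, 2 * pi]%R])
     (r ^+ 2 * sin t * f (spherical r t p))%:E =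
  \int[mu \x mu]_(z in rect)
    ((area_density r z)%:E * (f (spherical r z.1 z.2))%:E).
Proof.
move=> mf f0; rewrite integral_setX//.
- apply: emeasurable_funM; apply/measurable_EFinP => //.
  apply: measurableT_comp => //; exact: measurable_spherical.
- by move=> z /area_density_ge0 ?; rewrite mule_ge0 ?lee_fin.
Qed.

(** [sphere_area] is a real obtained by [fine], so the integral must be shown finite: its integrand
    is at most r^2 on a rectangle of finite measure. *)
Lemma sphere_areaE (r : R) B : measurable B ->
  (sphere_area r B)%:E = \int[mu \x mu]_(z in rect `&`
    (fun z => spherical r z.1 z.2) @^-1` B) (area_density r z)%:E.
Proof.
move=> mB.
have mh := measurable_spherical r.
have mS : measurable ((fun z : R * R => spherical r z.1 z.2) @^-1` B).
  by rewrite -[X in measurable X]setTI; exact: mh.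
have mRS := measurableI _ _ measurable_rect mS.
have itE : \int[mu]_(t in [set` `[0%R, pi]%R])
    \int[mu]_(p in [set` `[0%R, 2 * pi]%R])
    (r ^+ 2 * sin t * \1_B (spherical r t p))%:E =
  \int[mu \x mu]_(z in rect `&`
    (fun z => spherical r z.1 z.2) @^-1` B) (area_density r z)%:E.
  rewrite (@sphere_integralE r (\1_B))//.
  rewrite [RHS]integral_mkcondr; apply: eq_integral => z _.
  by rewrite epatch_indic.
rewrite /sphere_area itE fineK// ge0_fin_numE; last first.
  by apply: integral_ge0 => z [/area_density_ge0 ? _]; rewrite lee_fin.
apply: (@le_lt_trans _ _
    (\int[mu \x mu]_(z in rect `&` (fun z => spherical r z.1 z.2) @^-1` B)
    (cst (r ^+ 2)%:E z))).
  apply: ge0_le_integral => //=.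
  - by move=> z [/area_density_ge0 ? _]; rewrite lee_fin.
  - apply/measurable_EFinP; apply: measurable_funTS;
      exact: measurable_area_density.
  - by move=> z _; rewrite lee_fin ler_piMr ?sqr_ge0 ?sin_le1//.
rewrite integral_cst//.
have : (mu \x mu) (rect `&` (fun z => spherical r z.1 z.2) @^-1` B) < +oo.
  apply: (@le_lt_trans _ _ ((mu \x mu) rect)).
    by apply: le_measure; rewrite ?inE//; exact: subIsetl.
  rewrite /rect product_measure1E//.
  rewrite -[X in X * _ < _]/(lebesgue_measure _).
  rewrite -[X in _ * X < _]/(lebesgue_measure _).
  rewrite !lebesgue_measure_itv/=.
  by do 2 case: ifPn => _; rewrite ?mule0 ?mul0e// -!EFinB -EFinM ltry.
by move=> fin; apply: lte_mul_pinfty => //; rewrite lee_fin sqr_ge0.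
Qed.

Section Campbell.
Context {d : measure_display} {T : measurableType d}.
Variables (P : probability T R) (r lambda : R) (Phi : point_process T R).
Hypothesis lambda0 : (0 <= lambda)%R.
Hypothesis hPhi : poisson_on_sphere P r lambda Phi.

(** A sub-probability in [B]: its total mass is the probability that the point of index [m]
    exists. *)
Definition pp_law m B : \bar R := P (pp_event Phi m B).

(* [mseries pp_law 0] is the intensity measure of the process. *)
Section Law.
Variable m : nat.

Let pp_law0 : pp_law m set0 = 0.
Proof.
by rewrite /pp_law pp_eventE preimage_set0 setI0 measure0.
Qed.

Let pp_law_ge0 B : 0 <= pp_law m B.
Proof. exact: measure_ge0. Qed.

Let pp_law_sigma_additive : semi_sigma_additive (pp_law m).
Proof.
move=> F mF tF mUF; rewrite /pp_law.
rewrite pp_eventE preimage_bigcup setI_bigcupr.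
apply: measure_semi_sigma_additive.
- by move=> n; exact: (measurable_pp_event hPhi _ (mF n)).
- apply/trivIsetP => /= i j _ _ ij; rewrite -subset0 => w [[_ Fiw] [_ Fjw]].
  have : (F i `&` F j) (pp_point Phi m w) by [].
  by move/trivIsetP : tF => /(_ _ _ Logic.I Logic.I ij) ->.
- by rewrite -setI_bigcupr -preimage_bigcup;
    exact: (measurable_pp_event hPhi _ mUF).
Qed.

HB.instance Definition _ := isMeasure.Build _ _ _
  (pp_law m) pp_law0 pp_law_ge0 pp_law_sigma_additive.

End Law.

(** By [pp_intensity] and [sphere_areaE], the intensity measure and [lambda] times the surface
    measure agree on Borel sets, hence on nonnegative measurable functions. The left-hand side is
    the integral against the former, one law per index. *)
Lemma campbell (f : point3 R -> R) :
  measurable_fun setT f -> (forall x, 0 <= f x)%R ->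
  \sum_(m <oo) \int[P]_(w in pp_alive Phi m) (f (pp_point Phi m w))%:E =
  lambda%:E * \int[mu]_(t in [set` `[0%R, pi]%R])
    \int[mu]_(p in [set` `[0%R, 2 * pi]%R])
      (r ^+ 2 * sin t * f (spherical r t p))%:E.
Proof.
move=> mf f0; rewrite sphere_integralE//.
have mef : measurable_fun setT (fun x => (f x)%:E) by exact/measurable_EFinP.
have lawE m : \int[P]_(w in pp_alive Phi m) (f (pp_point Phi m w))%:E =
    \int[pp_law m]_x (f x)%:E.
  symmetry; rewrite (@ge0_integral_density _ _ _ _ _ P (pp_law m) (pp_alive
    Phi m)
    (cst 1%R) (pp_point Phi m)).
  - by apply: eq_integral => w _; rewrite mul1e.
  - exact: (measurable_pp_alive hPhi).
  - exact: measurable_cst.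
  - by move=> *; exact: ler01.
  - exact: (measurable_pp_point hPhi).
  - move=> B mB.
    by rewrite (integral_cst P (measurable_pp_event hPhi m mB) 1) mul1e.
  - exact: mef.
  - by move=> x; rewrite lee_fin.
rewrite (eq_eseriesr (fun m _ => lawE m)).
rewrite -(ge0_integral_measure_series _ measurableT)//.
have mhT : measurable_fun setT (fun z => lambda * area_density r z)%R.
  by apply: measurable_funM => //; exact: measurable_area_density.
have mh := measurable_funTS mhT : measurable_fun rect _.
have msph := measurable_spherical r.
rewrite (@ge0_integral_density _ _ _ _ _ (mu \x mu) _ rect
  (fun z => lambda * area_density r z)%R (fun z => spherical r z.1 z.2))//.
- rewrite -ge0_integralZl//.
  + by apply: eq_integral => z _; rewrite EFinM muleA.
  + apply: emeasurable_funM; apply/measurable_EFinP; apply: measurable_funTS.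
      exact: measurable_area_density.
    exact: measurableT_comp.
  + by move=> z /area_density_ge0 ?; rewrite mule_ge0 ?lee_fin.
- by move=> z /area_density_ge0 ?; rewrite mulr_ge0.
- exact: measurable_funTS.
- move=> B mB; rewrite /= /mseries/=.
  rewrite [LHS](pp_intensity hPhi mB) EFinM sphere_areaE// -ge0_integralZl//.
  + apply: measurableI => //; rewrite -[X in measurable X]setTI; exact: msph.
  + apply/measurable_EFinP; apply: measurable_funTS.
    exact: measurable_area_density.
  + by move=> z [/area_density_ge0 ? _]; rewrite lee_fin.
by move=> x _; rewrite lee_fin.
Qed.
End Campbell.
End Sphere.

(** * Rayleigh fading *)

Section Rayleigh.
Context {R : realType}.
Local Open Scope ereal_scope.
Local Notation mu := (@lebesgue_measure R).
Variable s : R.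
Hypothesis s0 : (0 < s)%R.

Lemma rayleigh_pdf_ge0 x : (0 <= rayleigh_pdf s x)%R.
Proof.
rewrite /rayleigh_pdf; case: ifPn => // x0.
by rewrite mulr_ge0 ?expR_ge0// divr_ge0// sqr_ge0.
Qed.

Lemma measurable_rayleigh_pdf : measurable_fun setT (rayleigh_pdf s).
Proof.
apply: measurable_fun_ifT => //; first exact: measurable_fun_ler.
apply: measurable_funM; first exact: measurable_funM.
apply: measurableT_comp => //; apply: measurable_funM => //.
by apply: measurableT_comp => //; exact: measurable_funX.
Qed.

Lemma rayleigh_expectation d (T : measurableType d) (P : probability T R)
    (X : T -> R) (g : R -> R) :
  measurable_fun setT X -> rayleigh_distributed P s X ->
  measurable_fun setT g -> (forall x, 0 <= g x)%R ->
  \int[P]_w (g (X w))%:E = \int[mu]_x (rayleigh_pdf s x * g x)%:E.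
Proof.
move=> mX hX mg g0.
have mge : measurable_fun setT (fun x => (g x)%:E) by exact/measurable_EFinP.
pose Y : {RV P >-> R} := mfun_Sub (mem_set mX).
transitivity (\int[distribution P Y]_y (g y)%:E).
  by rewrite ge0_integral_distribution//= => x; rewrite lee_fin.
transitivity (\int[mu]_x ((rayleigh_pdf s x)%:E * (g x)%:E)); last first.
  by apply: eq_integral => x _; rewrite EFinM.
apply: (@ge0_integral_density _ _ _ _ _ mu (distribution P Y) setT
  (rayleigh_pdf s) (fun x => x)) => //.
- exact: measurable_rayleigh_pdf.
- by move=> x _; exact: rayleigh_pdf_ge0.
- by move=> B mB; rewrite setTI preimage_id -hX.
Qed.

Local Close Scope ereal_scope.

Lemma rayleigh_second_moment :
  (\int[mu]_x (rayleigh_pdf s x * x ^+ 2)%:E = (2 * s ^+ 2)%:E)%E.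
Proof.
pose f x : R := (x / s ^+ 2 * expR (- x ^+ 2 / (2 * s ^+ 2)) * x ^+ 2)%R.
(* Antiderivative found by parts; it tends to 0 at infinity and equals -2 s^2 at 0, whence the value
   of the integral. *)
pose F x : R := (- (x ^+ 2 + 2 * s ^+ 2) * expR (- x ^+ 2 / (2 * s ^+ 2)))%R.
have s20 : (s ^+ 2 != 0)%R by rewrite sqrf_eq0 gt_eqF.
have dF (x : R) : is_derive x (1%R : R) F (f x).
  pose a := (2 * s ^+ 2)%R.
  have -> : F = ((- (id ^+ 2 + cst a)) *
      (expR \o ((- a^-1) \*: (id ^+ 2 : R -> R))))%R.
    apply/funext => y; rewrite /F -/a; congr (- _ * expR _)%R.
    by rewrite mulNr mulrC -mulNr.
  apply: is_derive_eq; rewrite /f/=.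
  have -> : (- x ^+ 2 / (2 * s ^+ 2))%R = (- a^-1 *: x ^+ 2)%R.
    by rewrite /a mulNr mulrC -mulNr.
  rewrite /GRing.scale/= expr1 /a !fctE. field; exact: lt0r_neq0.
have Fy : F x @[x --> +oo%R] --> (0 : R)%R.
  rewrite -[X in _ --> X]oppr0 (_ : F = - (fun x => - F x)%R); last first.
    by apply/funext => x; rewrite /= opprK.
  apply: cvgN; apply: (@squeeze_cvgr _ _ _ _ (cst 0%R)
     (fun x => 4 * s ^+ 2 * gauss_fun ((2 * s)^-1 * x))%R).
  - apply: nearW => x; rewrite /F mulNr opprK; apply/andP; split.
      apply: mulr_ge0; last exact: expR_ge0.
      by rewrite addr_ge0 ?sqr_ge0// mulr_ge0 ?sqr_ge0.
    (* The exponent is -2y. One factor exp(-y) absorbs the polynomial, since (1 + 2y) exp(-y) <= 2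
       follows from 1 + y <= exp(y); the other is the Gaussian that tends to 0. *)
    set y := (((2 * s)^-1 * x) ^+ 2)%R.
    have -> : (- x ^+ 2 / (2 * s ^+ 2) = - y - y)%R.
      by rewrite /y; field; exact: lt0r_neq0.
    have -> : (x ^+ 2 + 2 * s ^+ 2 = 2 * s ^+ 2 * (1 + 2 * y))%R.
      by rewrite /y; field; exact: lt0r_neq0.
    rewrite expRD mulrA /gauss_fun -/y; apply: ler_wpM2r; first exact: expR_ge0.
    have y0 : (0 <= y)%R by exact: sqr_ge0.
    have h : ((1 + 2 * y) * expR (- y) <= 2)%R.
      have E : 2 * expR y * expR (- y) = 2 by rewrite -mulrA -expRD subrr
        expR0 mulr1.
      rewrite -[leRHS]E.
      apply: ler_wpM2r; first exact: expR_ge0.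
      by have := expR_ge1Dx y; lra.
    have -> : 4 * s ^+ 2 = 2 * s ^+ 2 * 2 by ring.
    rewrite -[leLHS]mulrA; apply: ler_wpM2l => //.
    by rewrite mulr_ge0 ?sqr_ge0.
  - exact: cvg_cst.
  - rewrite -[X in _ --> X](mulr0 (4 * s ^+ 2)%R); apply: cvgM;
      first exact: cvg_cst.
    apply: (cvg_comp _ _ _ (@cvg_gauss_fun R)).
    by apply: gt0_cvgMry; [rewrite invr_gt0 mulr_gt0|exact: cvg_id].
have cF : continuous F.
  by move=> x; apply: differentiable_continuous; apply/derivable1_diffP;
    case: (dF x).
have cf : continuous f.
  move=> x; apply: cvgM; last exact: exprn_continuous.
  apply: cvgM; first exact: mulrr_continuous.
  apply: continuous_comp; last exact: continuous_expR.
  apply: cvgM; last exact: cvg_cst.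
  by apply: cvgN; exact: exprn_continuous.
have -> : (\int[mu]_x (rayleigh_pdf s x * x ^+ 2)%:E =
    \int[mu]_(x in [set` `[0%R, +oo[%R]) (f x)%:E)%E.
  rewrite [RHS]integral_mkcond; apply: eq_integral => x _.
  rewrite patchE /rayleigh_pdf; case: ifPn => [x0|x0].
    by rewrite mem_set//= in_itv/= x0.
  by rewrite memNset ?mul0r//= in_itv/= andbT; exact/negP.
rewrite (@ge0_continuous_FTC2y _ f F 0%R 0%R).
- rewrite -EFinB /F; congr (_%:E);
    rewrite expr0n/= oppr0 mul0r expR0 mulr1 add0r.
  by rewrite opprK add0r.
- move=> x x0; rewrite /f mulr_ge0 ?sqr_ge0// mulr_ge0 ?expR_ge0//.
  by rewrite divr_ge0// sqr_ge0.
- exact: continuous_subspaceT.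
- exact: Fy.
- by move=> x _; case: (dF x).
- by apply: cvg_at_right_filter; exact: cF.
- by move=> x _; rewrite derive1E; case: (dF x).
Qed.

Local Open Scope ereal_scope.

Lemma rayleigh_ln_lty : \int[mu]_x (rayleigh_pdf s x * `|ln x|)%:E < +oo.
Proof.
(* [x |ln x| <= 1] on [0, 1] and [ln x <= x^2] beyond *)
have m1 : measurable_fun setT (fun x =>
  ((s ^+ 2)^-1 * \1_(`[0%R, 1%R] : set R) x)%:E).
  by apply/measurable_EFinP; apply: measurable_funM => //;
    exact: measurable_indic.
have m2 : measurable_fun setT (fun x => (rayleigh_pdf s x * x ^+ 2)%:E).
  apply/measurable_EFinP; apply: measurable_funM => //.
    exact: measurable_rayleigh_pdf.
apply: (@le_lt_trans _ _ (\int[mu]_x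
  (((s ^+ 2)^-1 * \1_(`[0%R, 1%R] : set R) x)%:E + (rayleigh_pdf s x * x ^+
    2)%:E))).
  apply: ge0_le_integral => //.
  - by move=> x _; rewrite lee_fin mulr_ge0// rayleigh_pdf_ge0.
  - apply/measurable_EFinP; apply: measurable_funM;
      first exact: measurable_rayleigh_pdf.
    by apply: measurableT_comp => //; exact: measurable_ln.
  - by apply: emeasurable_funD.
  - move=> x _; rewrite -EFinD lee_fin.
    have pdf0 := rayleigh_pdf_ge0 x.
    have ind0 : (0 <= (s ^+ 2)^-1 * \1_(`[0%R, 1%R] : set R) x)%R.
      by rewrite mulr_ge0// invr_ge0 sqr_ge0.
    have [x0|x0] := leP x 0%R.
      suff -> : rayleigh_pdf s x = 0%R by rewrite !mul0r addr0.
      rewrite /rayleigh_pdf; case: ifPn => // x0'.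
      by have /eqP-> : x == 0%R; [rewrite eq_le x0|rewrite !mul0r].
    have [x1|x1] := leP x 1%R; last first.
      apply: (@le_trans _ _ (rayleigh_pdf s x * x ^+ 2)%R);
        last by rewrite lerDr.
      apply: ler_wpM2l => //; rewrite ger0_norm ?ln_ge0 1?ltW//.
      apply: (le_lt_trans (ltW (ln_sublinear x0))).
      by rewrite expr2 ltr_pMl.
    apply: (@le_trans _ _ ((s ^+ 2)^-1)%R); last first.
      rewrite indicE mem_set/= ?in_itv/= ?(ltW x0) ?x1// mulr1 lerDl.
      by rewrite mulr_ge0// sqr_ge0.
    have lnx : (`|ln x| <= x^-1)%R.
      rewrite ler0_norm ?ln_le0// -lnV ?posrE//.
      by rewrite ltW// ln_sublinear// invr_gt0.
    apply: (@le_trans _ _ (rayleigh_pdf s x * x^-1)%R); first exact: ler_wpM2l.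
    rewrite /rayleigh_pdf (ltW x0); set e := expR _.
    have -> : (x / s ^+ 2 * e / x = (s ^+ 2)^-1 * e)%R.
      by field; rewrite !gt_eqF.
    rewrite ler_piMr ?invr_ge0 ?sqr_ge0//.
    rewrite /e -expR0 ler_expR mulNr oppr_le0; apply: divr_ge0;
      first exact: sqr_ge0.
    by rewrite mulr_ge0 ?sqr_ge0.
rewrite ge0_integralD//.
- rewrite rayleigh_second_moment; under eq_integral do rewrite EFinM.
  rewrite ge0_integralZl//.
  + rewrite integral_indic//= setIT lebesgue_measure_itv/= lte_fin ltr01.
    by rewrite -EFinB -EFinM -EFinD ltry.
  + by apply/measurable_EFinP; exact: measurable_indic.
  + by rewrite lee_fin invr_ge0 sqr_ge0.
- by move=> x _; rewrite lee_fin mulr_ge0// invr_ge0 sqr_ge0.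
- by move=> x _; rewrite lee_fin mulr_ge0 ?sqr_ge0// rayleigh_pdf_ge0.
Qed.
End Rayleigh.

(** * The inverse-square law on spherical shells *)

Section Shell.
Context {R : realType}.
Local Notation mu := (@lebesgue_measure R).

(** Inversion is continuous except at 0, where its value is 0 by convention, so the line is split
    into the punctured line and the point 0. *)
Lemma measurable_invr : measurable_fun setT (@GRing.inv R).
Proof.
rewrite (_ : setT = [set x : R | x != 0] `|` [set 0]); last first.
  by apply/seteqP; split => // x _ /=; have [->|x0] := eqVneq x 0; [right|left].
have o : open [set x : R | x != 0].
  rewrite (_ : mkset _ = ~` [set 0]); first exact/closed_openC/closed_eq.
  by apply/seteqP; split => x /= /eqP.
apply/measurable_funU => //; first exact: open_measurable.
split; last exact: measurable_fun_set1.
apply: open_continuous_measurable_fun => // x; rewrite inE /= => x0.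
exact: inv_continuous.
Qed.

Lemma measurable_sqrtr : measurable_fun setT (@Num.sqrt R).
Proof. by apply: continuous_measurable_fun; exact: sqrt_continuous. Qed.

Lemma measurable_norm3 : measurable_fun setT (@norm3 R).
Proof.
apply: (measurableT_comp measurable_sqrtr).
apply: measurable_funD; last exact: measurable_funM.
apply: measurable_funD; apply: measurable_funM; exact: measurableT_comp.
Qed.

Lemma measurable_dist3 (y : point3 R) :
  measurable_fun setT (fun x => dist3 x y).
Proof.
apply: (measurableT_comp measurable_norm3).
apply/measurable_fun_pairP; split => /=; last exact: measurable_funB.
by apply/measurable_fun_pairP; split => /=; apply: measurable_funB => //;
  exact: measurableT_comp.
Qed.

Variables rs r : R.
Hypotheses (r0 : 0 < r) (r_rs : r < rs).
Let x1 : point3 R := (0, 0, rs).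

Lemma norm3_spherical t p : norm3 (spherical r t p) = r.
Proof.
rewrite /norm3 /dot3 /spherical/= (_ : _ + _ = r ^+ 2) ?sqrtr_sqr ?gtr0_norm//.
transitivity (r ^+ 2 * (cos t ^+ 2 + sin t ^+ 2 * (cos p ^+ 2 + sin p ^+ 2))).
  by ring.
by rewrite (cos2Dsin2 p) mulr1 cos2Dsin2 mulr1.
Qed.

Let sqd (t : R) : R := rs ^+ 2 + r ^+ 2 - 2 * rs * r * cos t.

Lemma dist3_spherical t p :
  dist3 (spherical r t p) x1 = Num.sqrt (sqd t).
Proof.
rewrite /dist3 /norm3 /dot3 /sub3/=; congr Num.sqrt.
transitivity (rs ^+ 2 - 2 * rs * r * cos t +
  r ^+ 2 * (cos t ^+ 2 + sin t ^+ 2 * (cos p ^+ 2 + sin p ^+ 2))).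
  by ring.
by rewrite (cos2Dsin2 p) mulr1 cos2Dsin2 mulr1 /sqd addrAC.
Qed.

Lemma sqd_gt0 t : 0 < sqd t.
Proof.
have rs0 := lt_trans r0 r_rs.
have : 0 < (rs - r) ^+ 2 by rewrite exprn_gt0// subr_gt0.
have : 0 <= 2 * rs * r * (1 - cos t).
  by rewrite mulr_ge0 ?subr_ge0 ?cos_le1// !mulr_ge0// ltW.
rewrite /sqd; lra.
Qed.

Lemma continuous_sin_div_sqd : continuous (fun t => sin t / sqd t).
Proof.
move=> t; apply: cvgM; first exact: continuous_sin.
apply: cvgV; first by rewrite gt_eqF// sqd_gt0.
apply: cvgB; first exact: cvg_cst.
by apply: cvgM; [exact: cvg_cst|exact: continuous_cos].
Qed.

(** The derivative of [sqd] is 2 rs r sin t, so the integrand is a logarithmic derivative up to a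
    constant. The exponent 2 of the path loss is what produces logarithms of distances. *)
Lemma integral_sin_div_sqd a b : a <= b ->
  (\int[mu]_(t in [set` `[a, b]]) (sin t / sqd t)%:E =
   ((ln (sqd b) - ln (sqd a)) / (2 * rs * r))%:E)%E.
Proof.
have rs0 := lt_trans r0 r_rs.
rewrite le_eqVlt => /predU1P[<-|ab].
  by rewrite set_itv1 integral_set1 subrr mul0r.
pose F t := ln (sqd t) / (2 * rs * r).
have dF (t : R) : is_derive t (1 : R) F (sin t / sqd t).
  have -> : F = ((2 * rs * r)^-1) \*: (@ln R \o
      (cst (rs ^+ 2 + r ^+ 2) - (2 * rs * r) \*: (@cos R))).
    by apply/funext => u; rewrite /F/= mulrC.
  have lnd : is_derive ((cst (rs ^+ 2 + r ^+ 2) - (2 * rs * r) \*: (@cos R)) t)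
      (1 : R) (@ln R) (sqd t)^-1.
    by apply: is_derive1_ln; exact: sqd_gt0.
  apply: is_derive_eq.
  rewrite /GRing.scale/=; field.
  by rewrite !gt_eqF// sqd_gt0.
have cF : continuous F.
  by move=> t; apply: differentiable_continuous; apply/derivable1_diffP;
    case: (dF t).
rewrite (@continuous_FTC2 _ _ F)//.
- by rewrite -EFinB mulrBl.
- exact/continuous_subspaceT/continuous_sin_div_sqd.
- split.
  + by move=> t _; case: (dF t).
  + by apply: cvg_at_right_filter; exact: cF.
  + by apply: cvg_at_left_filter; exact: cF.
- by move=> t _; rewrite derive1E; case: (dF t).
Qed.

(** The inverse-square law cut off to the points of the sphere whose distance to the satellite lies
    in [I]. Keeping the type of each end of [I] allows the cap of the base stations to be
    partitioned exactly at [R_psi]. *)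
Definition shell (I : interval R) (x : point3 R) : R :=
  \1_[set x | norm3 x = r /\ dist3 x x1 \in I] x * dist3 x x1 ^- 2.

Lemma shell_ge0 I x : 0 <= shell I x.
Proof. by rewrite mulr_ge0// invr_ge0 sqr_ge0. Qed.

Lemma measurable_shell I : measurable_fun setT (shell I).
Proof.
have md := measurable_dist3 x1.
apply: measurable_funM; last first.
  apply: (measurableT_comp measurable_invr); exact: measurable_funX.
apply: measurable_indic.
have -> : [set x | norm3 x = r /\ dist3 x x1 \in I] =
    (@norm3 R @^-1` [set r]) `&` ((fun x => dist3 x x1) @^-1` [set` I]).
  by apply/seteqP; split.
apply: measurableI; rewrite -[X in measurable X]setTI.
  exact: measurable_norm3.
by apply: md.
Qed.

(** Colatitude of the points of the sphere at distance [rho], by the law of cosines. The argument of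
    [acos] lies in [-1, 1] when rs - r <= rho <= rs + r. *)
Let angle (rho : R) : R := acos ((rs ^+ 2 + r ^+ 2 - rho ^+ 2) / (2 * rs * r)).

Let angleP (rho : R) : rs - r <= rho <= rs + r ->
  angle rho \in `[0, pi] /\ sqd (angle rho) = rho ^+ 2.
Proof.
move=> /andP[h1 h2]; have rs0 := lt_trans r0 r_rs.
have c0 : 0 < 2 * rs * r by rewrite !mulr_gt0.
have h : -1 <= (rs ^+ 2 + r ^+ 2 - rho ^+ 2) / (2 * rs * r) <= 1.
  have d0 : 0 <= rs - r by rewrite subr_ge0 ltW.
  have rho0 : 0 <= rho := le_trans d0 h1.
  have l : (rs - r) ^+ 2 <= rho ^+ 2 by exact: lerXn2r.
  have u : rho ^+ 2 <= (rs + r) ^+ 2.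
    by apply: lerXn2r; rewrite ?nnegrE// addr_ge0// ltW.
  rewrite ler_pdivlMr// ler_pdivrMr//; apply/andP; split; lra.
rewrite in_itv/= acos_ge0// acos_lepi//; split => //.
rewrite /sqd /angle acosK ?in_itv//=; field.
by rewrite !gt_eqF.
Qed.

Let sqd_lt (t u : R) : t \in `[0, pi] -> u \in `[0, pi] ->
  (sqd t < sqd u) = (t < u).
Proof.
move=> ht hu; have rs0 := lt_trans r0 r_rs.
rewrite /sqd ltrD2l ltrN2 ltr_pM2l ?mulr_gt0//; exact: ltr_cos.
Qed.

(** Distance increases with colatitude. Both strict comparisons are provided so that open and closed
    ends, the latter by negation, can be translated alike. *)
Let lt_angle (rho t : R) : rs - r <= rho <= rs + r -> t \in `[0, pi] ->
  (Num.sqrt (sqd t) < rho = (t < angle rho)) *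
  (rho < Num.sqrt (sqd t) = (angle rho < t)).
Proof.
move=> hr ht; have [ha e] := angleP hr.
have rho0 : 0 <= rho by move/andP: hr => [h _];
  rewrite (le_trans _ h)// subr_ge0 ltW.
have sr : Num.sqrt (sqd (angle rho)) = rho by rewrite e sqrtr_sqr ger0_norm.
by split; rewrite -{1}sr ltr_sqrt ?sqd_gt0 ?sqd_lt.
Qed.

Lemma shell_integral (b1 b2 : bool) (rho1 rho2 : R) :
  rs - r <= rho1 -> rho1 <= rho2 -> rho2 <= rs + r ->
  (\int[mu]_(t in [set` `[0%R, pi]%R]) \int[mu]_(p in [set` `[0%R, 2 * pi]%R])
     (r ^+ 2 * sin t *
       shell (Interval (BSide b1 rho1) (BSide b2 rho2)) (spherical r t p))%:E =
   (2 * pi * r / rs * ln (rho2 / rho1))%:E)%E.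
Proof.
move=> h1 h12 h2; have rs0 := lt_trans r0 r_rs.
have rr1 : rs - r <= rho1 <= rs + r by rewrite h1 (le_trans h12).
have rr2 : rs - r <= rho2 <= rs + r by rewrite h2 (le_trans h1).
have rho10 : 0 < rho1 by rewrite (lt_le_trans _ h1)// subr_gt0.
have rho20 : 0 < rho2 by rewrite (lt_le_trans rho10).
have [a1 e1] := angleP rr1; have [a2 e2] := angleP rr2.
pose I := Interval (BSide b1 rho1) (BSide b2 rho2).
pose J := Interval (BSide b1 (angle rho1)) (BSide b2 (angle rho2)).
have IJ t : t \in `[0, pi] -> (Num.sqrt (sqd t) \in I) = (t \in J).
  move=> ht; have [l1 u1] := lt_angle rr1 ht; have [l2 u2] := lt_angle rr2 ht.
  rewrite /I /J; case: (b1); case: (b2); rewrite !in_itv/=.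
  - by rewrite (leNgt rho1) l1 -leNgt l2.
  - by rewrite (leNgt rho1) l1 -leNgt (leNgt _ rho2) u2 -leNgt.
  - by rewrite u1 l2.
  - by rewrite u1 (leNgt _ rho2) u2 -leNgt.
have J0pi t : t \in J -> t \in `[0, pi].
  move: a1 a2; rewrite /J !in_itv/= => /andP[p1 _] /andP[_ p2].
  by case: (b1); case: (b2); move=> /= /andP[lo hi];
    rewrite (le_trans p1) ?(le_trans _ p2)// ltW.
have sqd0 t : 0 < sqd t := sqd_gt0 t.
have mquot : measurable_fun setT (fun t => (sin t / sqd t)%:E).
  apply/measurable_EFinP; apply: continuous_measurable_fun.
  exact: continuous_sin_div_sqd.
(* The integrand does not depend on the longitude, which contributes the factor 2 pi, and the
   interval of distances becomes the interval [J] of colatitudes. *)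
transitivity (\int[mu]_(t in [set` J])
  ((2 * pi * r ^+ 2)%:E * (sin t / sqd t)%:E))%E.
  rewrite integral_mkcond [RHS]integral_mkcond; apply: eq_integral => t _.
  rewrite !patchE; case: ifPn => [/set_mem/= ht|/negP ht]; last first.
    rewrite ifF//; apply/negP => /set_mem/= /J0pi tJ; apply: ht; exact/mem_set.
  under eq_integral => p _.
    rewrite /shell dist3_spherical indicE/= sqr_sqrtr ?(ltW (sqd0 _))//.
    have -> : (spherical r t p \in [set x | norm3 x = r /\ dist3 x x1 \in I])
      = (t \in J).
      rewrite -IJ// -(dist3_spherical t p).
      apply/idP/idP => [/set_mem[]//|dI]; apply/mem_set; split => //.
      exact: norm3_spherical.
    over.
  rewrite integral_cst// -[X in (_ * X)%E = _]/(lebesgue_measure _).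
  rewrite lebesgue_measure_itv/= lte_fin mulr_gt0 ?pi_gt0//.
  rewrite -EFinB subr0 -EFinM mem_setE/=.
  case: (t \in J); rewrite ?(mul1r, mul0r, mulr0)//.
  by rewrite -EFinM; congr (_%:E); field; rewrite gt_eqF.
rewrite ge0_integralZl_EFin//; last 3 first.
- move=> t /= /J0pi; rewrite lee_fin => tpi.
  by rewrite divr_ge0 ?sin_ge0_pi// ltW.
- exact: measurable_funTS.
- apply: mulr_ge0; last exact: sqr_ge0.
  by apply: mulr_ge0; rewrite ?pi_ge0.
(* Endpoints are null sets: [J] is replaced by its interior and then by its closure, to which the
   antiderivative applies. *)
rewrite integral_itv_bndoo; last exact: measurable_funTS.
rewrite -(@integral_itv_bndoo _ _ _ _ true false); last exact: measurable_funTS.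
rewrite integral_sin_div_sqd; last first.
  by rewrite leNgt -sqd_lt// e1 e2 -leNgt lerXn2r// nnegrE ltW.
rewrite e1 e2 -EFinM; congr (_%:E).
rewrite !lnXn// ln_div ?posrE//; field.
by rewrite !gt_eqF.
Qed.

End Shell.

(** * Distances and elevation angles *)

Section Geometry.
Context {R : realType}.
Implicit Types x y : point3 R.

Lemma dot3_ge0 x : 0 <= dot3 x x.
Proof. by rewrite /dot3 -!expr2 !addr_ge0 ?sqr_ge0. Qed.

Lemma norm3_sqr x : norm3 x ^+ 2 = dot3 x x.
Proof. by rewrite sqr_sqrtr ?dot3_ge0. Qed.

Lemma dist3_pole x (rs : R) :
  dist3 x (0, 0, rs) ^+ 2 = norm3 x ^+ 2 + rs ^+ 2 - 2 * rs * x.2.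
Proof. by rewrite !norm3_sqr /dot3 /sub3/=; ring. Qed.

Lemma pole_coord_le x : `|x.2| <= norm3 x.
Proof.
rewrite -(@ler_pXn2r _ 2) ?nnegrE ?normr_ge0 ?sqrtr_ge0//.
by rewrite norm3_sqr real_normK ?num_real// /dot3 -!expr2 lerDr addr_ge0
  ?sqr_ge0.
Qed.

(** The squared distance to the pole is affine in the third coordinate, which lies between -
    [norm3 x] and [norm3 x]; the two extremes are perfect squares. *)
Lemma dist3_pole_range x (rs : R) : norm3 x < rs ->
  rs - norm3 x <= dist3 x (0, 0, rs) <= rs + norm3 x.
Proof.
move=> xrs; have x0 : 0 <= norm3 x := sqrtr_ge0 _.
have rs0 : 0 <= rs by rewrite (le_trans x0)// ltW.
have d0 : 0 <= dist3 x (0, 0, rs) := sqrtr_ge0 _.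
have := pole_coord_le x; rewrite ler_norml => /andP[l u].
have l' : rs * - norm3 x <= rs * x.2 by exact: ler_wpM2l.
have u' : rs * x.2 <= rs * norm3 x by exact: ler_wpM2l.
have e := dist3_pole x rs.
rewrite -(@ler_pXn2r _ 2 _ (rs - norm3 x)) ?nnegrE ?subr_ge0 ?(ltW xrs)//.
rewrite -(@ler_pXn2r _ 2 _ (dist3 _ _)) ?nnegrE ?addr_ge0// e.
apply/andP; split; lra.
Qed.

Variable N : network R.
Hypothesis hN : network_assumptions N.
Let rs := R_s N.
Let rb := node_radius N base_station.

Lemma R_s_gt0 : 0 < R_s N.
Proof. exact: lt_trans (radius_gt0 hN sat_user) (radius_lt hN _). Qed.

Lemma R_min_gt0 o : 0 < R_min N o.
Proof. by rewrite subr_gt0; exact: radius_lt. Qed.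

Let theta_trig : 0 < cos (theta_s N) < 1 /\ 0 < sin (theta_s N).
Proof.
have /andP[t0 tpi] := theta_s_range hN.
have pi0 : 0 < pi :> R := pi_gt0 R.
split; last by rewrite sin_gt0_pihalf ?t0.
rewrite cos_gt0_pihalf ?tpi ?andbT ?(lt_trans _ t0) ?oppr_lt0 ?divr_gt0//=.
rewrite -(@cos0 R) ltr_cos// in_itv/= ?lexx ?ltW//=.
by rewrite (lt_trans tpi)// ltr_pdivrMr// mulr_natr mulr2n ltrDl.
Qed.

(** Writing q for the square root, R_max + q = R_s cos(theta_s), and squaring gives the identity.
    Geometrically it is the law of cosines at the rim of the cap, where q divided by the radius is
    the sine of the elevation. *)
Lemma R_max_eq o : R_max N o ^+ 2 + 2 * R_max N o *
    Num.sqrt (node_radius N o ^+ 2 - rs ^+ 2 * sin (theta_s N) ^+ 2) =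
  rs ^+ 2 - node_radius N o ^+ 2.
Proof.
have [_ sth] := theta_trig.
have h : 0 <= node_radius N o ^+ 2 - rs ^+ 2 * sin (theta_s N) ^+ 2.
  rewrite subr_ge0 -exprMn lerXn2r ?nnegrE ?mulr_ge0//; first exact/ltW/R_s_gt0.
  - exact: ltW.
  - exact/ltW/(radius_gt0 hN).
  - exact: (cap_defined hN).
have := sqr_sqrtr h; rewrite /R_max -/rs; set q := Num.sqrt _ => q2.
transitivity (rs ^+ 2 * cos (theta_s N) ^+ 2 - q ^+ 2); first by ring.
by rewrite q2 cos2sin2; ring.
Qed.

(** With r the node radius, R_max (R_max + 2q) and R_min (R_min + 2r) both equal R_s^2 - r^2. Since
    q < r, the distance R_max must be the larger one. *)
Lemma R_min_lt_R_max o : R_min N o < R_max N o.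
Proof.
have [/andP[c0 c1] s0] := theta_trig; have rs0 : 0 < rs := R_s_gt0.
have r0 := radius_gt0 hN o; have rrs := radius_lt hN o.
have := R_max_eq o; set q := Num.sqrt _ => e.
have q0 : 0 <= q := sqrtr_ge0 _.
have qr : q < node_radius N o.
  rewrite -[ltRHS]gtr0_norm// -sqrtr_sqr ltr_sqrt ?exprn_gt0//.
  by rewrite ltrBlDr ltrDl mulr_gt0// exprn_gt0.
rewrite ltNge; apply/negP => hle.
have Rmin0 := R_min_gt0 o.
have mq : 0 < R_max N o + 2 * q.
  have -> : R_max N o + 2 * q = rs * cos (theta_s N) + q.
    by rewrite /R_max -/rs -/q; ring.
  by rewrite ltr_wpDr// mulr_gt0.
have m0 : 0 < R_max N o.
  rewrite -(pmulr_lgt0 _ mq).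
  have -> : R_max N o * (R_max N o + 2 * q) =
      R_max N o ^+ 2 + 2 * R_max N o * q.
    by ring.
  by rewrite e subr_gt0 ltr_pXn2r// nnegrE ltW.
have : R_max N o * (R_max N o + 2 * q) <
    R_min N o * (R_min N o + 2 * node_radius N o).
  apply: (@le_lt_trans _ _ (R_min N o * (R_max N o + 2 * q))).
    by apply: ler_wpM2r => //; exact: ltW.
  by rewrite ltr_pM2l// ler_ltD// ltr_pM2l.
have -> : R_max N o * (R_max N o + 2 * q) = rs ^+ 2 - node_radius N o ^+ 2.
  by rewrite -e; ring.
have -> : R_min N o * (R_min N o + 2 * node_radius N o) =
    rs ^+ 2 - node_radius N o ^+ 2 by rewrite /R_min -/rs; ring.
by rewrite ltxx.
Qed.

Lemma R_max_le o : R_max N o <= R_s N + node_radius N o.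
Proof.
have [/andP[c0 c1] s0] := theta_trig.
rewrite /R_max lerBlDr (@le_trans _ _ (R_s N))//.
  by rewrite ler_piMr ?ltW// R_s_gt0.
rewrite -addrA lerDl addr_ge0 ?sqrtr_ge0// ltW//; exact: radius_gt0.
Qed.

(* The sine of the elevation of the satellite seen from distance d, by the law
   of cosines. *)
Let sin_elev (d : R) : R := (rs ^+ 2 - rb ^+ 2 - d ^+ 2) / (2 * d * rb).

(** The inner product in [elevation] is half of rs^2 - rb^2 - d^2, by expanding the squared distance
    d^2 from [b] to the satellite. *)
Lemma elevation_sat1 b : norm3 b = rb ->
  elevation b (sat1 N) = asin (sin_elev (dist3 b (sat1 N))).
Proof.
move=> nb; rewrite /elevation nb.
have -> : norm3 (sub3 (sat1 N) b) = dist3 b (sat1 N).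
  by rewrite /dist3 /norm3 /dot3 /sub3/=; congr Num.sqrt; ring.
congr asin; rewrite /sin_elev dist3_pole -/rs -nb !norm3_sqr.
rewrite /dot3 /sub3/=.
have b0 : norm3 b != 0 by rewrite nb gt_eqF// (radius_gt0 hN).
have d0 : dist3 b (sat1 N) != 0.
  have : norm3 b < rs by rewrite nb; exact: (radius_lt hN).
  move=> h; have /andP[dh _] := dist3_pole_range h.
  by rewrite gt_eqF// (lt_le_trans _ dh)// subr_gt0.
rewrite /rs; field.
by rewrite b0 d0.
Qed.

(** Elevations are compared through their sines, sin being increasing on [-pi/2, pi/2]. The
    comparison with [psi1] removes the main-lobe case, and the one with [psi2] becomes a comparison
    of distances. An elevation equal to [psi2] corresponds to the distance [R_psi] and gets the gain
    [G_bH]. *)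
Lemma G_b_visible b :
  norm3 b = rb -> dist3 b (sat1 N) <= R_max N base_station ->
  G_b N b = if dist3 b (sat1 N) < R_psi N then G_bL N else G_bH N.
Proof.
move=> nb; rewrite /G_b elevation_sat1//; set d := dist3 _ _ => dM.
have rb0 : 0 < rb := radius_gt0 hN _; have rbrs : rb < rs := radius_lt hN _.
have [d1 d2] : rs - rb <= d /\ d <= rs + rb.
  by apply/andP; rewrite -nb; apply: dist3_pole_range; rewrite nb.
have d0 : 0 < d by rewrite (lt_le_trans _ d1)// subr_gt0.
have c0 : 0 < 2 * d * rb by rewrite !mulr_gt0.
(* Completing squares, the two bounds are the triangle inequalities (d - rb)^2 <= rs^2 and rs^2 <=
   (d + rb)^2. *)
have s1 : -1 <= sin_elev d <= 1.
  have l : (rs - rb) ^+ 2 <= d ^+ 2.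
    by rewrite ler_pXn2r// nnegrE ?subr_ge0 ltW.
  have u : (d - rb) ^+ 2 <= rs ^+ 2.
    rewrite -[leRHS]real_normK ?num_real// -[leLHS]real_normK ?num_real//.
    rewrite ler_pXn2r ?nnegrE// (gtr0_norm R_s_gt0) -/rs ler_norml.
    by move: d1 d2 d0 rb0 rbrs; clear; move=> *; apply/andP; split; lra.
  have l' : rs ^+ 2 <= (d + rb) ^+ 2.
    rewrite ler_pXn2r// ?nnegrE ?addr_ge0 ?(ltW R_s_gt0) ?(ltW d0) ?(ltW rb0)//.
    by rewrite -lerBlDr.
  rewrite /sin_elev ler_pdivlMr// ler_pdivrMr//.
  by move: l u l'; clear; move=> *; apply/andP; split; lra.
have pi0 : 0 < pi :> R := pi_gt0 R.
have elev_in : asin (sin_elev d) \in `[- (pi / 2), pi / 2].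
  by rewrite in_itv/= asin_geNpi2 ?asin_lepi2.
have sinK' : sin (asin (sin_elev d)) = sin_elev d by rewrite asinK.
(* [acos u] is the elevation at the rim of the cap, hence a lower bound for every visible base
   station; by [R_max_eq] its sine is the value of [sin_elev] at the distance [R_max]. *)
have psi1_lt : psi1 N < asin (sin_elev d).
  have [_ sth] := theta_trig.
  pose u := rs / rb * sin (theta_s N).
  have u01 : 0 <= u <= 1.
    rewrite mulr_ge0 ?divr_ge0 ?(ltW sth) ?(ltW rb0) ?(ltW R_s_gt0)//=.
    by rewrite /u mulrAC ler_pdivrMr// mul1r; exact: (cap_defined hN).
  have u11 : -1 <= u <= 1 by move/andP: u01 => [h ->]; rewrite (le_trans _ h).
  apply: (lt_le_trans (psi1_visible hN)); rewrite -/u.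
  have ae : acos u \in `[- (pi / 2), pi / 2].
    have a0 := acos_ge0 u11; have api := acos_lepi u11.
    rewrite in_itv/= (le_trans _ a0) ?oppr_le0 ?divr_ge0 ?(ltW pi0)//=.
    rewrite leNgt -ltr_cos ?in_itv/= ?a0 ?api ?divr_ge0 ?(ltW pi0)//;
      last first.
      by rewrite ler_pdivrMr// mulr_natr mulr2n lerDl ltW.
    rewrite acosK ?in_itv//= cos_pihalf -leNgt; by case/andP: u01.
  rewrite leNgt -ltr_sin// sinK' -leNgt sin_acos//.
  rewrite /sin_elev ler_pdivlMr//.
  set q := Num.sqrt _.
  have qE : rb * q = Num.sqrt (rb ^+ 2 - rs ^+ 2 * sin (theta_s N) ^+ 2).
    rewrite -{1}(gtr0_norm rb0) -sqrtr_sqr -sqrtrM ?sqr_ge0//; congr Num.sqrt.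
    by rewrite /u; field; rewrite gt_eqF.
  have := R_max_eq base_station; rewrite -/rb -qE => e.
  have q0 : 0 <= q := sqrtr_ge0 _.
  have M2 : d ^+ 2 <= R_max N base_station ^+ 2.
    by rewrite ler_pXn2r// nnegrE ltW// (lt_le_trans d0).
  have Mq : d * (rb * q) <= R_max N base_station * (rb * q).
    by rewrite ler_wpM2r// mulr_ge0// ltW.
  by move: e M2 Mq; clear; move=> *; lra.
rewrite psi1_lt; congr (if _ then _ else _).
have psi2_in : psi2 N \in `[- (pi / 2), pi / 2].
  rewrite in_itv/= (psi2_le hN) andbT (le_trans (psi1_ge hN))// ltW//.
  exact: (psi1_lt_psi2 hN).
rewrite -ltr_sin// sinK' /sin_elev ltr_pdivlMr//.
pose k := rb * sin (psi2 N).
have [p1 p2] := andP (R_psi_range hN).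
have psi0 : 0 < R_psi N by rewrite (lt_le_trans _ p1)// R_min_gt0.
(* Thus [R_psi] is a root of x^2 + 2kx = rs^2 - rb^2. The difference to be signed factors through
   this root, and [pk] makes the other factor positive. *)
have psiE : (R_psi N + k) ^+ 2 = rs ^+ 2 - rb ^+ 2 + k ^+ 2.
  rewrite /R_psi -/rs -/rb -/k subrK sqr_sqrtr ?cos2sin2; first by rewrite /k;
    ring.
  rewrite subr_ge0 (@le_trans _ _ (rb ^+ 2))//.
    by rewrite ler_piMr ?sqr_ge0// lerBlDr lerDl sqr_ge0.
  by apply: lerXn2r; rewrite ?nnegrE ltW// R_s_gt0.
have psik0 : 0 <= R_psi N + k by rewrite /R_psi -/rb -/k subrK sqrtr_ge0.
have pk : 0 < R_psi N + 2 * k.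
  have : `|k| < R_psi N + k.
    rewrite -(@ltr_pXn2r _ 2) ?nnegrE// real_normK ?num_real// psiE ltrDr
      subr_gt0.
    by rewrite ltr_pXn2r// nnegrE ltW// R_s_gt0.
  rewrite ltr_norml => /andP[kl _].
  have -> : R_psi N + 2 * k = (R_psi N + k) + k by ring.
  by rewrite -ltrBlDl sub0r.
rewrite -subr_gt0.
have -> : rs ^+ 2 - rb ^+ 2 - d ^+ 2 - sin (psi2 N) * (2 * d * rb) =
    (R_psi N - d) * (d + (R_psi N + 2 * k)).
  rewrite (_ : rs ^+ 2 - rb ^+ 2 = (R_psi N + k) ^+ 2 - k ^+ 2).
    by rewrite /k; ring.
  by rewrite psiE addrK.
by rewrite pmulr_lgt0 ?subr_gt0// addr_gt0.
Qed.
End Geometry.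

(** * Independence *)

Section Independence.
Context {R : realType} {d : measure_display} {T : measurableType d}.
Local Open Scope ereal_scope.
Variables (P : probability T R).

Lemma mutually_independent2 (I : Type) (F : I -> set (set T)) (i j : I)
    (A B : set T) : mutually_independent P F -> i <> j -> F i A -> F j B ->
  P (A `&` B) = (fine (P A) * fine (P B))%:E.
Proof.
move=> PF ij FA FB.
pose h (l : 'I_2) := nth i [:: i; j] l.
pose E (l : 'I_2) := nth A [:: A; B] l.
have := PF 2%N h E.
rewrite !big_ord_recl big_ord0 mulr1/= => <-.
- congr (P _); apply/seteqP; split=> [w [Aw Bw] [[|[|//]] ?] _ //|w Ew].
  by split; [exact: (Ew ord0)|exact: (Ew (lift ord0 ord0))].
- by case=> [[|[|//]] ?] [[|[|//]] ?]; rewrite /h/= => e; apply/val_inj => //=;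
    exfalso; apply: ij.
- by case=> [[|[|//]] ?].
Qed.

Lemma mutually_independent3 (I : Type) (F : I -> set (set T)) (i j k : I)
    (A B C : set T) : mutually_independent P F -> i <> j -> i <> k -> j <> k ->
  F i A -> F j B -> F k C ->
  P (A `&` B `&` C) = (fine (P A) * fine (P B) * fine (P C))%:E.
Proof.
move=> PF ij ik jk FA FB FC.
pose h (l : 'I_3) := nth i [:: i; j; k] l.
pose E (l : 'I_3) := nth A [:: A; B; C] l.
have := PF 3%N h E.
rewrite !big_ord_recl big_ord0 mulr1 mulrA/= => <-.
- congr (P _); apply/seteqP; split=> [w [[Aw Bw] Cw] [[|[|[|//]]] ?] _ //|w Ew].
  split; last exact: (Ew (lift ord0 (lift ord0 ord0))).
  by split; [exact: (Ew ord0)|exact: (Ew (lift ord0 ord0))].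
- by case=> [[|[|[|//]]] ?] [[|[|[|//]]] ?]; rewrite /h/= => e;
    apply/val_inj => //=;
    exfalso; first [exact: ij|exact: ik|exact: jk
                   |exact/ij/esym|exact/ik/esym|exact/jk/esym].
- by case=> [[|[|[|//]]] ?].
Qed.

Lemma sigma_ppI (Phi : point_process T R) (A B : set T) :
  sigma_pp Phi A -> sigma_pp Phi B -> sigma_pp Phi (A `&` B).
Proof.
by rewrite /sigma_pp; set G := (X in <<s X >>);
  exact: (@measurableI _ (g_sigma_algebraType G)).
Qed.

Lemma sigma_pp_event (Phi : point_process T R) m (B : set (point3 R)) :
  measurable B -> sigma_pp Phi (pp_event Phi m B).
Proof. by move=> mB; apply: sub_sigma_algebra; exists m, B. Qed.

Lemma sigma_pp_measurable r lambda (Phi : point_process T R) (A : set T) :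
  poisson_on_sphere P r lambda Phi -> sigma_pp Phi A -> measurable A.
Proof.
move=> hPhi; apply: smallest_sub; first exact: sigma_algebra_measurable.
by move=> _ [m [B [mB ->]]]; exact: hPhi.1.
Qed.

Lemma sigma_fading_preimage (H : node -> nat -> {RV P >-> R}) o m (C : set R) :
  measurable C -> sigma_fading H (H o m @^-1` C).
Proof. by move=> mC; apply: sub_sigma_algebra; exists o, m, C. Qed.

(** The restriction of P to [V] and the multiple P(V) P have the same image under [X], which is the
    assumed product rule. *)
Lemma integral_indep (V : set T) (X : {RV P >-> R}) :
  measurable V -> (forall w, 0 <= X w)%R ->
  (forall C, measurable C ->
    P (V `&` X @^-1` C) = (fine (P V) * fine (P (X @^-1` C)))%:E) ->
  \int[P]_(w in V) (X w)%:E = P V * \int[P]_w (X w)%:E.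
Proof.
move=> mV X0 indep.
have mX : measurable_fun setT X by exact: measurable_funPT.
have mabs : measurable_fun setT (fun x : R => `|x|%:E).
  by apply/measurable_EFinP; exact: normr_measurable.
(* The absolute value supplies a function that is nonnegative on the whole line, as
   [eq_integral_density] requires, and that is the identity on the values of [X]. *)
have XE w : (X w)%:E = (1%R : R)%:E * `|X w|%:E by rewrite mul1e ger0_norm.
have PV0 : (0 <= fine (P V))%R.
  by apply: fine_ge0; exact: (measure_ge0 P V).
transitivity (\int[P]_(w in V) ((1%R : R)%:E * `|X w|%:E)).
  by apply: eq_integral => w _; exact: XE.
rewrite (@eq_integral_density _ _ _ _ _ _ _ P P V setT (cst 1%R) (cst (fine (P
  V))) X X _ _ _ _ _ _ _ _ _ _ mabs)//.
- transitivity ((fine (P V))%:E * \int[P]_w (X w)%:E); last first.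
    by rewrite fineK// fin_num_measure.
  rewrite -ge0_integralZl//.
  + by apply: eq_integral => w _; rewrite ger0_norm.
  + exact/measurable_EFinP.
  + by move=> w _; rewrite lee_fin.
- exact: measurable_funTS.
- move=> C mC.
  have mXC : measurable (X @^-1` C) by exact: measurable_funPTI.
  rewrite setTI (integral_cst P (measurableI _ _ mV mXC) 1) mul1e.
  rewrite (integral_cst P mXC (fine (P V))%:E).
  transitivity (P (V `&` X @^-1` C)) => //.
  by rewrite indep// EFinM (fineK (fin_num_measure P _ mXC)).
Qed.

End Independence.

(** * Mean of the interference *)

Section ShotNoise.
Context {R : realType} {d : measure_display} {T : measurableType d}.
Context {P : probability T R} {N : network R} {Phi : node -> point_process T R}.
Context {H : node -> nat -> {RV P >-> R}} {s : R} {W : set T}.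
Local Open Scope ereal_scope.
Local Notation mu := (@lebesgue_measure R).
Hypothesis hN : network_assumptions N.
Hypothesis hS : stochastic_assumptions N Phi H s.
Hypothesis hW : serving_event P Phi W.

Lemma measurable_served : measurable W.
Proof. by have [+ _ _] := hW; apply: sigma_pp_measurable;
  exact: (Phi_poisson hS). Qed.

Lemma served_prob_gt0 : (0 < fine (P W))%R.
Proof.
have [_ W0 _] := hW; rewrite fine_gt0// W0/= -ge0_fin_numE ?measure_ge0//.
exact: (fin_num_measure P _ measurable_served).
Qed.

Let mH o m : measurable_fun setT (H o m).
Proof. exact: measurable_funPT. Qed.

Lemma fading_mean o m : \int[P]_w (H o m w)%:E = (2 * s ^+ 2)%:E.
Proof.
have mX : measurable_fun setT (fun w => Num.sqrt (H o m w)).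
  exact: (measurableT_comp measurable_sqrtr).
have := rayleigh_expectation mX (fading_rayleigh hS o m) (exprn_measurable 2)
  (@sqr_ge0 R).
rewrite rayleigh_second_moment ?(scale_gt0 hS)// => <-.
by apply: eq_integral => w _; rewrite sqr_sqrtr// (fading_ge0 hS).
Qed.

Let indep := processes_fading_independent hS.

Lemma served_event_prob o m B : o <> sat_user -> measurable B ->
  P (W `&` pp_event (Phi o) m B) =
  (fine (P W) * fine (P (pp_event (Phi o) m B)))%:E.
Proof.
move=> osat mB; have [FW _ _] := hW.
apply: (mutually_independent2 (i := Some sat_user) (j := Some o) indep) => //.
- by case=> /esym.
- exact: sigma_pp_event.
Qed.

(** For satellite users [W] and the point event share a sigma-algebra, so their intersection is a
    single event independent of the fading; for the other processes three independent families are
    involved. *)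
Lemma served_event_fading_indep o m B o' m' C : measurable B -> measurable C ->
  P (W `&` pp_event (Phi o) m B `&` H o' m' @^-1` C) =
  (fine (P (W `&` pp_event (Phi o) m B)) * fine (P (H o' m' @^-1` C)))%:E.
Proof.
move=> mB mC; have [FW _ _] := hW.
have FB : sigma_pp (Phi o) (pp_event (Phi o) m B) by exact: sigma_pp_event.
have FC : sigma_fading H (H o' m' @^-1` C) by exact: sigma_fading_preimage.
have [osat|osat] : o = sat_user \/ o <> sat_user by case: (o);
  [left|right|right].
  rewrite osat in FB *.
  apply: (mutually_independent2 (i := Some sat_user) (j := None) indep) => //.
  exact: sigma_ppI.
rewrite served_event_prob//=.
apply: (mutually_independent3 (i := Some sat_user) (j := Some o) (k := None)
  indep) => //.
by case=> /esym.
Qed.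

Let mW := measurable_served.

Let alive o m := W `&` pp_alive (Phi o) m.

Let measurable_alive o m : measurable (alive o m).
Proof. exact: measurableI mW (measurable_pp_alive (Phi_poisson hS o) m). Qed.

Let measurable_point o m : measurable_fun (alive o m) (pp_point (Phi o) m).
Proof.
move=> _ B mB; have -> : alive o m `&` pp_point (Phi o) m @^-1` B =
    W `&` pp_event (Phi o) m B by rewrite /alive -setIA.
by apply: measurableI mW _; exact: (measurable_pp_event (Phi_poisson hS o)).
Qed.

Let alive_event o m B : alive o m `&` pp_point (Phi o) m @^-1` B =
  W `&` pp_event (Phi o) m B.
Proof. by rewrite /alive -setIA. Qed.

Let measurable_event o m B :
  measurable B -> measurable (W `&` pp_event (Phi o) m B).
Proof. by move=> mB; apply: measurableI mW _;
  exact: (measurable_pp_event (Phi_poisson hS o)). Qed.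

Section Term.
Variable f : point3 R -> R.
Hypotheses (mf : measurable_fun setT f) (f0 : forall x, (0 <= f x)%R).

Let mef : measurable_fun setT (fun x => (f x)%:E).
Proof. exact/measurable_EFinP. Qed.

Let s20 : (0 <= 2 * s ^+ 2)%R. Proof. by rewrite mulr_ge0 ?sqr_ge0. Qed.

(** Within [W] and the existence of the point, the weights [H o m] and 2 s^2 have the same image on
    the space of points, because the fading is independent of [W] and of the location together. *)
Lemma fading_term_mean o m :
  \int[P]_(w in alive o m) (H o m w * f (pp_point (Phi o) m w))%:E =
  (2 * s ^+ 2)%:E * \int[P]_(w in alive o m) (f (pp_point (Phi o) m w))%:E.
Proof.
transitivity (\int[P]_(w in alive o m) ((H o m w)%:E * (f (pp_point (Phi o) m
  w))%:E)).
  by apply: eq_integral => w _; rewrite EFinM.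
rewrite (@eq_integral_density _ _ _ _ _ _ _ P P (alive o m) (alive o m) (H o m)
  (cst (2 * s ^+ 2)%R) (pp_point (Phi o) m) (pp_point (Phi o) m) _ _ _ _ _ _ _
    _ _ _ mef)//.
- rewrite -ge0_integralZl//.
  + apply/measurable_EFinP; apply: measurableT_comp => //;
      exact: measurable_point.
  + by move=> w _; rewrite lee_fin.
- by apply: measurable_funTS; exact: mH.
- by move=> w _; exact: (fading_ge0 hS).
- move=> B mB; rewrite alive_event.
  rewrite (integral_cst P (measurable_event o m mB) (2 * s ^+ 2)%:E).
  rewrite (@integral_indep _ _ _ P _ (H o m) (measurable_event o m mB)).
  + by rewrite fading_mean muleC.
  + exact: (fading_ge0 hS).
  + by move=> C mC; exact: served_event_fading_indep.
Qed.

Lemma served_term_mean o m : o <> sat_user ->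
  \int[P]_(w in alive o m) (f (pp_point (Phi o) m w))%:E =
  P W * \int[P]_(w in pp_alive (Phi o) m) (f (pp_point (Phi o) m w))%:E.
Proof.
move=> osat; have hPhi := Phi_poisson hS o.
have PW0 : (0 <= fine (P W))%R by exact/ltW/served_prob_gt0.
transitivity (\int[P]_(w in alive o m) ((1%R : R)%:E * (f (pp_point (Phi o) m
  w))%:E)).
  by apply: eq_integral => w _; rewrite mul1e.
rewrite (@eq_integral_density _ _ _ _ _ _ _ P P (alive o m) (pp_alive (Phi o)
  m) (cst 1%R)
  (cst (fine (P W))) (pp_point (Phi o) m) (pp_point (Phi o) m) _ _ _ _ _ _ _ _
    _ _ mef)//.
- transitivity ((fine (P W))%:E *
    \int[P]_(w in pp_alive (Phi o) m) (f (pp_point (Phi o) m w))%:E);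
      last first.
    by rewrite (fineK (fin_num_measure P _ mW)).
  rewrite -ge0_integralZl//.
  + exact: (measurable_pp_alive hPhi).
  + apply/measurable_EFinP; apply: measurableT_comp => //;
      exact: (measurable_pp_point hPhi).
  + by move=> w _; rewrite lee_fin.
- exact: (measurable_pp_alive hPhi).
- exact: (measurable_pp_point hPhi).
- move=> B mB; rewrite alive_event.
  rewrite (integral_cst P (measurable_event o m mB) 1) mul1e.
  rewrite (integral_cst P (measurable_pp_event hPhi m mB) (fine (P W))%:E).
  have mE := measurable_pp_event hPhi m mB.
  by rewrite -[X in _ = _ * X](fineK (fin_num_measure P _ mE)) -EFinM
    -served_event_prob.
Qed.

(** The restriction to a visible cap is left to [f]. The start [k] is 1 for the satellite users,
    whose point of index 0 is the serving one, and 0 for terrestrial interference. *)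
Definition shot_noise o k w : R :=
  (\sum_(k <= m < pp_size (Phi o) w) H o m w * f (pp_point (Phi o) m w))%R.

Let summand o k m w : R :=
  if [&& (m < pp_size (Phi o) w)%N, (k <= m)%N & true]
  then (H o m w * f (pp_point (Phi o) m w))%R else 0%R.

Let shot_noise_series o k w :
  (shot_noise o k w)%:E = \sum_(m <oo) (summand o k m w)%:E.
Proof.
rewrite /shot_noise -nneseries_finite_support// => m.
by rewrite mulr_ge0// (fading_ge0 hS).
Qed.

Let summand_ge0 o k m w : (0 <= summand o k m w)%R.
Proof. by rewrite /summand; case: ifP => // _;
  rewrite mulr_ge0// (fading_ge0 hS). Qed.

Let measurable_summand o k m : measurable_fun setT (summand o k m).
Proof.
have hPhi := Phi_poisson hS o; have mA := measurable_pp_alive hPhi m.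
have [km|km] := boolP (k <= m)%N; last first.
  by rewrite (_ : summand o k m = cst 0%R)//; apply/funext => w;
    rewrite /summand (negbTE km) andbF.
have -> : summand o k m =
    (fun w => H o m w * f (pp_point (Phi o) m w))%R \_ (pp_alive (Phi o) m).
  apply/funext => w; rewrite /summand km !andbT patchE.
  by congr (if _ then _ else _); apply/idP/idP => [?|/set_mem//];
    exact: mem_set.
apply/(measurable_restrictT _ mA); apply: measurable_funM.
  by apply: measurable_funTS; exact: mH.
by apply: measurableT_comp => //; exact: (measurable_pp_point hPhi).
Qed.

Lemma shot_noise_ge0 o k w : (0 <= shot_noise o k w)%R.
Proof. by apply: sumr_ge0 => m _; rewrite mulr_ge0// (fading_ge0 hS). Qed.

Lemma measurable_shot_noise o k : measurable_fun setT (shot_noise o k).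
Proof.
apply/measurable_EFinP;
  rewrite (_ : _ \o _ = fun w => \sum_(m <oo) (summand o k m w)%:E).
  apply: ge0_emeasurable_sum => [m w _ _|m _]; first by rewrite lee_fin.
  exact/measurable_EFinP/measurable_summand.
by apply/funext => w /=; rewrite shot_noise_series.
Qed.

Let shot_noise_mean_series o : \int[P]_(w in W) (shot_noise o 0 w)%:E =
  (2 * s ^+ 2)%:E *
  \sum_(m <oo) \int[P]_(w in alive o m) (f (pp_point (Phi o) m w))%:E.
Proof.
transitivity (\int[P]_(w in W) \sum_(m <oo) (summand o 0 m w)%:E).
  by apply: eq_integral => w _; exact: shot_noise_series.
rewrite integral_nneseries//; last 2 first.
- by move=> m; apply/measurable_EFinP/measurable_funTS/measurable_summand.
- by move=> m w _; rewrite lee_fin.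
rewrite -nneseriesZl//; last first.
  by move=> m _; apply: integral_ge0 => w _; rewrite lee_fin.
apply: eq_eseriesr => m _; rewrite -fading_term_mean /alive integral_mkcondr.
apply: eq_integral => w _; rewrite patchE /summand leq0n !andbT.
by rewrite (fun_if EFin); congr (if _ then _ else _);
  apply/idP/idP => [?|/set_mem//]; exact: mem_set.
Qed.

Let sphere_mean o := \int[mu]_(t in [set` `[0%R, pi]%R])
  \int[mu]_(p in [set` `[0%R, 2 * pi]%R])
    (node_radius N o ^+ 2 * sin t * f (spherical (node_radius N o) t p))%:E.

Lemma shot_noise_mean o : o <> sat_user ->
  \int[P]_(w in W) (shot_noise o 0 w)%:E =
  (2 * s ^+ 2)%:E * (P W * ((density N o)%:E * sphere_mean o)).
Proof.
move=> osat; rewrite shot_noise_mean_series; congr (_ * _).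
rewrite /sphere_mean -(campbell (ltW (density_gt0 hN o)) (Phi_poisson hS o) mf
  f0).
have fW := fineK (fin_num_measure P _ mW).
transitivity ((fine (P W))%:E * \sum_(m <oo)
    \int[P]_(w in pp_alive (Phi o) m) (f (pp_point (Phi o) m w))%:E);
      last by rewrite fW.
rewrite -nneseriesZl//; last first.
  by move=> m _; apply: integral_ge0 => w _; rewrite lee_fin.
by apply: eq_eseriesr => m _; rewrite served_term_mean// fW.
Qed.

(** Meant for the satellite users, who are not independent of [W]. Putting back the points of index
    below [k] and enlarging [W] to the whole space only increases the mean, and Campbell's formula
    then bounds it. *)
Lemma shot_noise_mean_le o k : \int[P]_(w in W) (shot_noise o k w)%:E <=
  (2 * s ^+ 2)%:E * ((density N o)%:E * sphere_mean o).
Proof.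
have hPhi := Phi_poisson hS o.
apply: (@le_trans _ _ (\int[P]_(w in W) (shot_noise o 0 w)%:E)).
  apply: ge0_le_integral => //.
  - by move=> w _; rewrite lee_fin shot_noise_ge0.
  - by apply/measurable_EFinP/measurable_funTS/measurable_shot_noise.
  - by apply/measurable_EFinP/measurable_funTS/measurable_shot_noise.
  - move=> w _; rewrite !shot_noise_series; apply: lee_nneseries => [m _|m _];
      first by rewrite lee_fin.
    rewrite lee_fin /summand leq0n; case: (m < _)%N => //=; case: ifP => // _.
    by rewrite mulr_ge0// (fading_ge0 hS).
rewrite shot_noise_mean_series lee_wpmul2l ?lee_fin//.
rewrite /sphere_mean -(campbell (ltW (density_gt0 hN o)) hPhi mf f0).
apply: lee_nneseries => [m _ _|m _]; first by apply: integral_ge0 => w _;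
  rewrite lee_fin.
apply: ge0_subset_integral => //.
- exact: (measurable_pp_alive hPhi).
- by apply/measurable_EFinP; apply: measurableT_comp => //;
    exact: (measurable_pp_point hPhi).
- by move=> w _; rewrite lee_fin.
- exact: subIsetr.
Qed.

End Term.
End ShotNoise.

(** * Logarithmic moments *)

Section Bounds.
Context {R : realType}.
Local Notation mu := (@lebesgue_measure R).

Lemma norm_ln_le (x : R) : 0 < x -> `|ln x| <= x + x^-1.
Proof.
move=> x0; have xV0 : 0 < x^-1 by rewrite invr_gt0.
have h1 := ltW (ln_sublinear x0); have := ltW (ln_sublinear xV0).
rewrite lnV ?posrE// => h2; rewrite ler_norml; apply/andP; split.
  by rewrite lerNl (le_trans h2)// lerDr ltW.
by rewrite (le_trans h1)// lerDl ltW.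
Qed.

(** When [h] or [D] vanishes, the conventions 0^-1 = 0 and ln 0 = 0 make the left-hand side 0. *)
Lemma norm_ln_signal_le (c h D : R) : 0 < c -> 0 <= h -> 0 <= D ->
  `|ln (c * h * D ^- 2)| <= `|ln c| + `|ln h| + 2 * `|ln D|.
Proof.
move=> c0 h0 D0.
have rhs0 : 0 <= `|ln c| + `|ln h| + 2 * `|ln D| by rewrite !addr_ge0//
  mulr_ge0.
move: h0; rewrite le_eqVlt => /predU1P[h0|h0].
  by rewrite -{1}h0 mulr0 mul0r ln0// normr0.
move: D0; rewrite le_eqVlt => /predU1P[D0|D0].
  by rewrite -{1}D0 expr0n invr0 mulr0 ln0// normr0.
have D20 : 0 < D ^+ 2 by rewrite exprn_gt0.
rewrite !lnM ?posrE ?mulr_gt0 ?invr_gt0// lnV ?posrE// lnXn//.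
rewrite (le_trans (ler_normD _ _))// lerD ?ler_normD//.
by rewrite normrN normrMn mulr_natl.
Qed.

Lemma sphere_ln_dist_lty (rs r : R) : 0 < r -> r < rs ->
  (\int[mu]_(t in [set` `[0%R, pi]%R]) \int[mu]_(p in [set` `[0%R, 2 * pi]%R])
     (r ^+ 2 * sin t * `|ln (dist3 (spherical r t p) (0, 0, rs))|)%:E < +oo)%E.
Proof.
move=> r0 rrs.
pose D t : R := Num.sqrt (rs ^+ 2 + r ^+ 2 - 2 * rs * r * cos t).
(* From |ln x| <= x + 1/x and rs - r <= x <= rs + r: the sphere stays away from the satellite, so
   the logarithm of the distance is bounded. *)
pose K : R := rs + r + (rs - r)^-1.
have Drange t : rs - r <= D t <= rs + r.
  have := @dist3_pole_range _ (spherical r t 0) rs.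
  by rewrite norm3_spherical// dist3_spherical//; exact.
have lnK t : `|ln (D t)| <= K.
  have /andP[l u] := Drange t; have m0 : 0 < rs - r by rewrite subr_gt0.
  rewrite (le_trans (norm_ln_le (lt_le_trans m0 l)))// lerD//.
  by rewrite lef_pV2// posrE ?(lt_le_trans m0).
have mcos : measurable_fun setT (@cos R).
  by apply: continuous_measurable_fun; exact: continuous_cos.
have msin : measurable_fun setT (@sin R).
  by apply: continuous_measurable_fun; exact: continuous_sin.
have mD : measurable_fun setT D.
  apply: (measurableT_comp measurable_sqrtr).
  by apply: measurable_funB => //; exact: measurable_funM.
have muitv b : 0 < b -> mu [set` `[0, b]] = b%:E.
  by move=> b0; rewrite lebesgue_measure_itv/= lte_fin b0 -EFinB subr0.
have pi2 : 0 < 2 * pi :> R by rewrite mulr_gt0 ?pi_gt0.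
have -> : (\int[mu]_(t in [set` `[0%R, pi]%R])
    \int[mu]_(p in [set` `[0%R, 2 * pi]%R])
     (r ^+ 2 * sin t * `|ln (dist3 (spherical r t p) (0, 0, rs))|)%:E =
    \int[mu]_(t in [set` `[0%R, pi]%R])
      (r ^+ 2 * sin t * `|ln (D t)| * (2 * pi))%:E)%E.
  apply: eq_integral => t _.
  transitivity (\int[mu]_(p in [set` `[0%R, 2 * pi]%R])
    (cst (r ^+ 2 * sin t * `|ln (D t)|)%:E p))%E.
    by apply: eq_integral => p _; rewrite dist3_spherical.
  by rewrite integral_cst// -[X in (_ * X)%E = _]/(lebesgue_measure _) muitv//
    -EFinM.
apply: (@le_lt_trans _ _ (\int[mu]_(t in [set` `[0%R, pi]%R])
    (cst (r ^+ 2 * K * (2 * pi))%:E t)))%E.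
  apply: ge0_le_integral => //.
  - move=> t /=; rewrite in_itv/= => tpi.
    have st : 0 <= sin t by rewrite sin_ge0_pi// in_itv.
    rewrite lee_fin; apply: mulr_ge0; last exact: ltW.
    by apply: mulr_ge0 => //; apply: mulr_ge0 => //; exact: sqr_ge0.
  - apply/measurable_EFinP; apply: measurable_funTS;
      apply: measurable_funM => //.
    apply: measurable_funM; first exact: measurable_funM.
    apply: measurableT_comp => //; exact: measurableT_comp.
  - move=> t /=; rewrite in_itv/= => tpi.
    rewrite lee_fin ler_wpM2r ?(ltW pi2)// -mulrA ler_wpM2l ?sqr_ge0//.
    have st : 0 <= sin t by rewrite sin_ge0_pi// in_itv.
    by rewrite -[leRHS]mul1r ler_pM// sin_le1.
rewrite integral_cst//; apply: lte_mul_pinfty => //.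
  rewrite lee_fin; apply: mulr_ge0; last exact: ltW.
  by apply: mulr_ge0; [exact: sqr_ge0|exact: le_trans (lnK 0)].
by rewrite -[X in (X < _)%E]/(lebesgue_measure _) muitv ?pi_gt0// ltry.
Qed.

End Bounds.

(** * Comparison of the lower bounds *)

Section Corollary.
Context {R : realType} {d : measure_display} {T : measurableType d}.
Context {P : probability T R} {N : network R} {Phi : node -> point_process T R}.
Context {H : node -> nat -> {RV P >-> R}} {s : R} {W : set T}.
Hypothesis hN : network_assumptions N.
Hypothesis hS : stochastic_assumptions N Phi H s.
Hypothesis hW : serving_event P Phi W.

Local Notation shot := (@shot_noise R d T P Phi H).
Local Notation rad := (node_radius N).

Let mW := measurable_served hS hW.
Let PW0 := served_prob_gt0 hS hW.
Let PWE : (fine (P W))%:E = P W := fineK (fin_num_measure P _ mW).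

Lemma cond_expectation_EFin (X : T -> R) (x : R) :
  (\int[P]_(w in W) (X w)%:E = (fine (P W) * x)%:E)%E ->
  cond_expectation P W X = x%:E.
Proof.
move=> e; rewrite /cond_expectation e -PWE inver gt_eqF// -EFinM.
by congr (_%:E); field; rewrite gt_eqF.
Qed.

(** Mean fading power times density times the constant of [shell_integral]: the mean interference
    for unit gain and power, per unit of the logarithm of the distance ratio. *)
Let kappa o : R := 2 * s ^+ 2 * density N o * (2 * pi * rad o / R_s N).

Lemma shot_shell_mean o b1 b2 (rho1 rho2 : R) : o <> sat_user ->
  R_min N o <= rho1 -> rho1 <= rho2 -> rho2 <= R_max N o ->
  (\int[P]_(w in W) (shot (shell (R_s N) (rad o)
     (Interval (BSide b1 rho1) (BSide b2 rho2))) o 0 w)%:E =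
   (fine (P W) * (kappa o * ln (rho2 / rho1)))%:E)%E.
Proof.
move=> osat h1 h12 h2.
rewrite (shot_noise_mean hN hS hW (@measurable_shell _ _ _ _) (@shell_ge0 _ _
  _ _))//.
rewrite shell_integral//; [|exact: (radius_gt0 hN)|exact: (radius_lt hN)|];
  last first.
  exact: le_trans h2 (R_max_le hN o).
by rewrite -PWE -!EFinM; congr (_%:E); rewrite /kappa; ring.
Qed.

Lemma visible_capE o (x : point3 R) : (x \in visible_cap N o) =
  (norm3 x == rad o) && (dist3 x (sat1 N) <= R_max N o).
Proof.
by apply/idP/andP => [/set_mem[/eqP ? ?]|[/eqP ? ?]]; [split|apply/mem_set;
  split].
Qed.

Lemma shellE o (I : interval R) (x : point3 R) : shell (R_s N) (rad o) I x =
  if (norm3 x == rad o) && (dist3 x (sat1 N) \in I) then path_loss N x else 0.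
Proof.
rewrite /shell indicE -[X in _ * X = _]mul1r; case: ifPn => [/andP[/eqP ? ?]|h].
  by rewrite mem_set ?mul1r.
rewrite memNset ?mul0r// => -[/eqP n i]; by rewrite n i in h.
Qed.

Lemma R_min_le_dist o (x : point3 R) :
  norm3 x = rad o -> R_min N o <= dist3 x (sat1 N).
Proof.
move=> nx; have : norm3 x < R_s N by rewrite nx; exact: (radius_lt hN).
by move=> /dist3_pole_range /andP[+ _]; rewrite nx.
Qed.

Local Notation full o :=
  (Interval (BSide true (R_min N o)) (BSide false (R_max N o))).

(** No point of the sphere is closer than [R_min], so the lower end of [full] excludes nothing. *)
Lemma shell_fullE o (x : point3 R) : shell (R_s N) (rad o) (full o) x =
  if x \in visible_cap N o then path_loss N x else 0.
Proof.
rewrite shellE visible_capE; congr (if _ then _ else _).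
by case: eqP => //= nx; rewrite in_itv/= R_min_le_dist.
Qed.

Lemma I_s_upE w : I_s_up N Phi H w =
  G_us N * power N sat_user *
  shot (shell (R_s N) (rad sat_user) (full sat_user)) sat_user 1 w.
Proof.
rewrite /I_s_up /shot_noise big_mkcond mulr_sumr; apply: eq_bigr => l _.
by rewrite shell_fullE; case: ifP => _; ring.
Qed.

Lemma I_t_upE w : I_t_up N Phi H w =
  G_ut N * power N terr_user *
  shot (shell (R_s N) (rad terr_user) (full terr_user)) terr_user 0 w.
Proof.
rewrite /I_t_up /shot_noise big_mkcond mulr_sumr; apply: eq_bigr => l _.
by rewrite shell_fullE; case: ifP => _; ring.
Qed.

Local Notation low := (shell (R_s N) (rad base_station)
  (Interval (BSide true (R_min N base_station)) (BSide true (R_psi N)))).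
Local Notation high := (shell (R_s N) (rad base_station)
  (Interval (BSide true (R_psi N)) (BSide false (R_max N base_station)))).

Lemma I_t_dnE w : I_t_dn N Phi H w =
  power N base_station * G_bL N * shot low base_station 0 w +
  power N base_station * G_bH N * shot high base_station 0 w.
Proof.
rewrite /I_t_dn /shot_noise big_mkcond !mulr_sumr -big_split;
  apply: eq_bigr => l _ /=.
set x := pp_point _ _ _; rewrite !shellE visible_capE.
have [p1 p2] := andP (R_psi_range hN).
case: eqP => /= [nx|_]; last by ring.
rewrite !in_itv/= R_min_le_dist//=.
have [xM|xM] := leP (dist3 x (sat1 N)) (R_max N base_station); last first.
  by rewrite andbF ltNge (le_trans p2 (ltW xM))/=; ring.
rewrite (G_b_visible hN nx xM) leNgt andbT; case: (dist3 x _ < _) => /=; ring.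
Qed.

Lemma carrier_gain_gt0 : 0 < carrier_gain N.
Proof.
by rewrite exprn_gt0// divr_gt0 ?(c_0_gt0 hN)// mulr_gt0 ?(f_c_gt0 hN)//
  mulr_gt0 ?pi_gt0.
Qed.

Lemma G_us_1_gt0 : 0 < G_us_1 N.
Proof. exact: mulr_gt0 (mulr_gt0 (G_s_main_gt0 hN) (G_us_main_gt0 hN))
  carrier_gain_gt0. Qed.
Lemma G_us_gt0 : 0 < G_us N.
Proof. exact: mulr_gt0 (mulr_gt0 (G_s_side_gt0 hN) (G_us_side_gt0 hN))
  carrier_gain_gt0. Qed.
Lemma G_ut_gt0 : 0 < G_ut N.
Proof. exact: mulr_gt0 (mulr_gt0 (G_s_side_gt0 hN) (G_ut_side_gt0 hN))
  carrier_gain_gt0. Qed.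
Lemma G_bL_gt0 : 0 < G_bL N.
Proof. exact: mulr_gt0 (mulr_gt0 (G_s_side_gt0 hN) (G_bL_side_gt0 hN))
  carrier_gain_gt0. Qed.
Lemma G_bH_gt0 : 0 < G_bH N.
Proof. exact: mulr_gt0 (mulr_gt0 (G_s_side_gt0 hN) (G_bH_side_gt0 hN))
  carrier_gain_gt0. Qed.

Lemma I_t_up_mean : cond_expectation P W (I_t_up N Phi H) =
  (G_ut N * power N terr_user *
    (kappa terr_user * ln (R_max N terr_user / R_min N terr_user)))%:E.
Proof.
apply: cond_expectation_EFin.
have c0 : 0 <= G_ut N * power N terr_user.
  by rewrite mulr_ge0// ltW// ?G_ut_gt0// (power_gt0 hN).
under eq_integral do rewrite I_t_upE EFinM.
have ms := measurable_shot_noise hS (@measurable_shell _ (R_s N) (rad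
  terr_user) (full terr_user)) (@shell_ge0 _ _ _ _) terr_user 0.
rewrite ge0_integralZl_EFin//; last 2 first.
- by move=> w _; rewrite lee_fin (shot_noise_ge0 hS)// => x; exact: shell_ge0.
- by apply/measurable_EFinP; exact: measurable_funTS ms.
rewrite shot_shell_mean//; last exact/ltW/(R_min_lt_R_max hN).
by rewrite -EFinM; congr (_%:E); ring.
Qed.

Lemma I_t_dn_mean : cond_expectation P W (I_t_dn N Phi H) =
  (power N base_station * kappa base_station *
    (G_bL N * ln (R_psi N / R_min N base_station) +
     G_bH N * ln (R_max N base_station / R_psi N)))%:E.
Proof.
apply: cond_expectation_EFin.
have [p1 p2] := andP (R_psi_range hN).
have cL : 0 <= power N base_station * G_bL N.
  by rewrite mulr_ge0// ltW// ?G_bL_gt0// (power_gt0 hN).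
have cH : 0 <= power N base_station * G_bH N.
  by rewrite mulr_ge0// ltW// ?G_bH_gt0// (power_gt0 hN).
under eq_integral do rewrite I_t_dnE EFinD [X in (X + _)%E]EFinM [X in (_ +
  X)%E]EFinM.
have ms I : measurable_fun W
    (fun w => (shot (shell (R_s N) (rad base_station) I) base_station 0 w)%:E).
  apply/measurable_EFinP/measurable_funTS.
  exact: (measurable_shot_noise hS (@measurable_shell _ _ _ I) (@shell_ge0 _ _
    _ _)).
have s0 I w : (0 <= (shot (shell (R_s N) (rad base_station) I) base_station 0
  w)%:E)%E.
  by rewrite lee_fin (shot_noise_ge0 hS)// => x; exact: shell_ge0.
rewrite ge0_integralD//; last 4 first.
- by move=> w _; rewrite mule_ge0// lee_fin.
- exact: emeasurable_funM.
- by move=> w _; rewrite mule_ge0// lee_fin.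
- exact: emeasurable_funM.
rewrite !ge0_integralZl_EFin// !shot_shell_mean// -?EFinM -EFinD.
by congr (_%:E); ring.
Qed.

Lemma I_s_up_mean :
  exists2 b : R, 0 <= b & cond_expectation P W (I_s_up N Phi H) = b%:E.
Proof.
pose f := shell (R_s N) (rad sat_user) (full sat_user).
have f0 x : 0 <= f x by exact: shell_ge0.
have mf : measurable_fun setT f by exact: measurable_shell.
have sh0 w : 0 <= shot f sat_user 1 w by exact: (shot_noise_ge0 hS).
pose J := (\int[P]_(w in W) (shot f sat_user 1 w)%:E)%E.
have J0 : (0 <= J)%E by apply: integral_ge0 => w _; rewrite lee_fin.
have Jfin : J \is a fin_num.
  rewrite ge0_fin_numE//;
    apply: le_lt_trans (shot_noise_mean_le hN hS hW mf f0 _ _) _.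
  rewrite shell_integral ?ltry//; last exact: R_max_le.
  - exact: (radius_gt0 hN).
  - exact: (radius_lt hN).
  - exact/ltW/(R_min_lt_R_max hN).
have c0 : 0 <= G_us N * power N sat_user.
  by rewrite mulr_ge0// ltW// ?G_us_gt0// (power_gt0 hN).
have JE : J = (fine J)%:E by rewrite fineK.
exists (G_us N * power N sat_user * fine J / fine (P W)).
  by rewrite divr_ge0 ?(ltW PW0)// mulr_ge0// fine_ge0.
apply: cond_expectation_EFin.
under eq_integral do rewrite I_s_upE EFinM.
rewrite ge0_integralZl_EFin//; last 2 first.
- by move=> w _; rewrite lee_fin.
- by apply/measurable_EFinP;
    exact: measurable_funTS (measurable_shot_noise hS mf f0 _ _).
by rewrite -/J JE -EFinM; congr (_%:E); field; rewrite gt_eqF.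
Qed.

Lemma ln_fading_lty o m : (\int[P]_w (`|ln (H o m w)|)%:E < +oo)%E.
Proof.
have mX : measurable_fun setT (fun w => Num.sqrt (H o m w)).
  apply: (measurableT_comp measurable_sqrtr); exact: measurable_funPT.
have mg : measurable_fun setT (fun x : R => `|ln x|).
  by apply: measurableT_comp => //; exact: measurable_ln.
have e w : (`|ln (H o m w)|)%:E = (2%:E * (`|ln (Num.sqrt (H o m w))|)%:E)%E.
  have h0 := fading_ge0 hS o m w.
  move: (h0); rewrite le_eqVlt => /predU1P[<-|hp].
    by rewrite sqrtr0 ln0// normr0 mule0.
  by rewrite -{1}(sqr_sqrtr h0) lnXn ?sqrtr_gt0// normrMn -EFinM mulr_natl.
under eq_integral do rewrite e.
rewrite ge0_integralZl_EFin//; last first.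
  by apply/measurable_EFinP; exact: (measurableT_comp mg).
rewrite (rayleigh_expectation mX (fading_rayleigh hS o m) mg)//.
by apply: lte_mul_pinfty => //; exact: (rayleigh_ln_lty (scale_gt0 hS)).
Qed.

Let x0 := pp_point (Phi sat_user) 0.

Let W_alive : W `<=` pp_alive (Phi sat_user) 0.
Proof. by have [_ _] := hW. Qed.

Let mx0 : measurable_fun W x0.
Proof.
have hPhi := Phi_poisson hS sat_user.
move=> _ B mB; rewrite (_ : _ `&` _ = W `&` pp_event (Phi sat_user) 0 B).
  by apply: measurableI => //; exact: (measurable_pp_event hPhi).
apply/seteqP; split => [w [Ww Bw]|w [Ww [_ Bw]]]; split => //; split => //.
exact: W_alive.
Qed.

Let mdist : measurable_fun setT (fun x : point3 R => dist3 x (sat1 N)).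
Proof. exact: measurable_dist3. Qed.

(** The law of the nearest user is never computed: its term is one of the nonnegative terms of the
    Campbell series over all satellite users, and that series is finite. *)
Lemma ln_dist_lty :
  (\int[P]_(w in W) (`|ln (dist3 (x0 w) (sat1 N))|)%:E < +oo)%E.
Proof.
have hPhi := Phi_poisson hS sat_user.
pose f (x : point3 R) : R := `|ln (dist3 x (sat1 N))|.
have mf : measurable_fun setT f.
  apply: measurableT_comp => //; apply: measurableT_comp mdist;
    exact: measurable_ln.
have f0 (x : point3 R) : 0 <= f x by exact: normr_ge0.
have c := campbell (ltW (density_gt0 hN sat_user)) hPhi mf f0.
apply: (@le_lt_trans _ _ (\int[P]_(w in pp_alive (Phi sat_user) 0) (f (x0
  w))%:E)%E).
  apply: ge0_subset_integral => //.
  - exact: (measurable_pp_alive hPhi).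
  - apply/measurable_EFinP; apply: measurableT_comp mf _.
    exact: (measurable_pp_point hPhi).
apply: (@le_lt_trans _ _ (\sum_(m <oo) \int[P]_(w in pp_alive (Phi sat_user) m)
    (f (pp_point (Phi sat_user) m w))%:E)%E).
  rewrite (nneseriesD1 (n := 0%N))//.
    rewrite leeDl// nneseries_ge0// => m _ _.
    by apply: integral_ge0 => w _; rewrite lee_fin f0.
  by move=> m _; apply: integral_ge0 => w _; rewrite lee_fin f0.
rewrite c; apply: lte_mul_pinfty => //;
  first by rewrite lee_fin (ltW (density_gt0 hN _)).
exact: sphere_ln_dist_lty (radius_gt0 hN _) (radius_lt hN _).
Qed.

Lemma ln_signal_mean :
  exists a : R, cond_expectation P W (fun w => ln (signal N Phi H w)) = a%:E.
Proof.
have c0 : 0 < G_us_1 N * power N sat_user by rewrite mulr_gt0 ?G_us_1_gt0//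
  (power_gt0 hN).
set c := G_us_1 N * _ in c0.
have mD : measurable_fun W (fun w => dist3 (x0 w) (sat1 N)).
  exact: (measurableT_comp mdist).
have mHT : measurable_fun setT (H sat_user 0) by exact: measurable_funPT.
have mH : measurable_fun W (H sat_user 0) by exact: measurable_funTS.
have mln := @measurable_ln R.
have msig : measurable_fun W (fun w => ln (signal N Phi H w)).
  apply: (measurableT_comp mln); apply: measurable_funM;
    first exact: measurable_funM.
  by apply: (measurableT_comp measurable_invr); exact: measurable_funX.
have m1 : measurable_fun W (fun w => (`|ln (H sat_user 0 w)|)%:E).
  by apply/measurable_EFinP; apply: measurableT_comp => //;
    exact: measurableT_comp.
have m2 : measurable_fun W (fun w => (`|ln (dist3 (x0 w) (sat1 N))|)%:E).
  by apply/measurable_EFinP; apply: measurableT_comp => //;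
    exact: measurableT_comp.
have PWfin : (P W < +oo)%E by rewrite -PWE ltry.
have int_sig : P.-integrable W (fun w => (ln (signal N Phi H w))%:E).
  apply/integrableP; split; first exact/measurable_EFinP.
  apply: (@le_lt_trans _ _ (\int[P]_(w in W) ((`|ln c|)%:E +
    ((`|ln (H sat_user 0 w)|)%:E + 2%:E * (`|ln (dist3 (x0 w) (sat1
      N))|)%:E)))%E).
    apply: ge0_le_integral => //.
    - by apply/measurable_EFinP; apply: measurableT_comp.
    - apply: emeasurable_funD => //; apply: emeasurable_funD => //.
      exact: emeasurable_funM.
    - move=> w _; rewrite -EFinM -!EFinD lee_fin addrA.
      apply: norm_ln_signal_le => //; [exact: (fading_ge0 hS)|exact: sqrtr_ge0].
  rewrite ge0_integralD//; last 2 first.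
  - by move=> w _; rewrite adde_ge0// mule_ge0.
  - by apply: emeasurable_funD => //; exact: emeasurable_funM.
  rewrite ge0_integralD//; last exact: emeasurable_funM.
  rewrite ge0_integralZl_EFin//.
  apply: lte_add_pinfty; first by rewrite integral_cst//; apply: lte_mul_pinfty.
  apply: lte_add_pinfty; last by apply: lte_mul_pinfty => //;
    exact: ln_dist_lty.
  apply: le_lt_trans (ln_fading_lty sat_user 0).
  apply: ge0_subset_integral => //.
  apply/measurable_EFinP; apply: measurableT_comp => //.
  exact: (measurableT_comp mln mHT).
have := integrable_fin_num mW int_sig; set J := integral _ _ _ => Jfin.
exists (fine J / fine (P W)); apply: cond_expectation_EFin.
by rewrite -/J mulrC divfK ?gt_eqF// fineK.
Qed.

(** Since the noise may be 0, positivity of the denominator comes from x > 0; it brings the division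
    and the logarithm in the extended reals back to the real ones. *)
Lemma LB_upE (a b x : R) (I_t : T -> R) : 0 <= b -> 0 < x ->
  cond_expectation P W (fun w => ln (signal N Phi H w)) = a%:E ->
  cond_expectation P W (I_s_up N Phi H) = b%:E ->
  cond_expectation P W I_t = x%:E ->
  LB_up N Phi H W I_t = (ln (1 + expR a / (b + x + noise N)) / ln 2)%:E.
Proof.
move=> b0 xp Ea Eb Ex; rewrite /LB_up Ea Eb Ex.
have -> : cond_expectation P W (cst (noise N)) = (noise N)%:E.
  apply: cond_expectation_EFin; rewrite (integral_cst P mW (noise N)%:E).
  by rewrite [in RHS]mulrC EFinM PWE.
have D0 : 0 < b + x + noise N by rewrite ltr_wpDr ?(noise_ge0 hN)// ltr_wpDl.
have q0 : 0 < expR a / (b + x + noise N) by rewrite divr_gt0// expR_gt0.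
have ln20 : 0 < ln 2 :> R by rewrite ln_gt0// ltr1n.
rewrite /log2e /= -!EFinD inver gt_eqF// -EFinM -EFinD lne_EFin ?addr_gt0//.
by rewrite inver gt_eqF.
Qed.

End Corollary.

Theorem corollary1 (R : realType) (d : measure_display) (T : measurableType d)
    (P : probability T R) (N : network R) (Phi : node -> point_process T R)
    (H : node -> nat -> {RV P >-> R}) (s : R) (served : set T)
    (hN : network_assumptions N)
    (hS : stochastic_assumptions N Phi H s)
    (hserved : serving_event P Phi served)
    (hratio : density N terr_user / density N base_station
                <= density_ratio_bound N) :
  (LB_up N Phi H served (I_t_dn N Phi H)
     <= LB_up N Phi H served (I_t_up N Phi H))%E
  /\ (density N terr_user / density N base_station < density_ratio_bound N ->
      (LB_up N Phi H served (I_t_dn N Phi H)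
         < LB_up N Phi H served (I_t_up N Phi H))%E).
Proof.
have [a Ea] := ln_signal_mean hN hS hserved.
have [b b0 Eb] := I_s_up_mean hN hS hserved.
have Eup := I_t_up_mean hN hS hserved.
have Edn := I_t_dn_mean hN hS hserved.
set xup := (X in _ = X%:E) in Eup; set xdn := (X in _ = X%:E) in Edn.
(* The two means are K times the two sides of the density ratio condition. *)
have s0 := scale_gt0 hS; have rs0 := R_s_gt0 hN; have pi0 := pi_gt0 R.
have put := power_gt0 hN terr_user; have rut := radius_gt0 hN terr_user.
have lut := density_gt0 hN terr_user; have lb := density_gt0 hN base_station.
have gut := G_ut_gt0 hN.
have lnut : 0 < ln (R_max N terr_user / R_min N terr_user).
  by rewrite ln_gt0// ltr_pdivlMr ?mul1r ?(R_min_gt0 hN)// (R_min_lt_R_max hN).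
(* [K] is the UL mean divided by the density ratio; it therefore contains the denominators of
   [density_ratio_bound], which cancel in the DL mean. *)
pose K : R := 2 * s ^+ 2 * (2 * pi / R_s N) * power N terr_user *
  node_radius N terr_user * G_ut N *
  ln (R_max N terr_user / R_min N terr_user) * density N base_station.
have K0 : 0 < K.
  by do !apply: mulr_gt0 => //; rewrite ?exprn_gt0 ?invr_gt0.
have xupE : xup = K * (density N terr_user / density N base_station).
  by rewrite /xup /K; field; rewrite !gt_eqF.
have xdnE : xdn = K * density_ratio_bound N.
  by rewrite /xdn /K /density_ratio_bound; field; rewrite !gt_eqF.
have xup0 : 0 < xup by rewrite xupE mulr_gt0// divr_gt0.
have updn : xup <= xdn by rewrite xupE xdnE ler_pM2l.
have xdn0 : 0 < xdn := lt_le_trans xup0 updn.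
rewrite (LB_upE hN hS hserved b0 xdn0 Ea Eb Edn).
rewrite (LB_upE hN hS hserved b0 xup0 Ea Eb Eup).
have ln20 : 0 < ln 2 :> R by rewrite ln_gt0// ltr1n.
have D0 x : 0 < x -> 0 < b + x + noise N.
  by move=> x0; rewrite ltr_wpDr ?(noise_ge0 hN)// ltr_wpDl.
have q0 x : 0 < x -> 0 < 1 + expR a / (b + x + noise N).
  by move=> x0; rewrite addr_gt0// divr_gt0 ?D0// expR_gt0.
split=> [|hlt].
  rewrite lee_fin ler_pM2r ?invr_gt0// ler_ln ?posrE ?q0// lerD2l.
  by rewrite ler_pM2l ?expR_gt0// lef_pV2 ?posrE ?D0// lerD2r lerD2l.
have ltupdn : xup < xdn by rewrite xupE xdnE ltr_pM2l.
rewrite lte_fin ltr_pM2r ?invr_gt0// ltr_ln ?posrE ?q0// ltrD2l.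
by rewrite ltr_pM2l ?expR_gt0// ltf_pV2 ?posrE ?D0// ltrD2r ltrD2l.
Qed.
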